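(* Let $\varphi:[0,\infty)\to(0,\infty)$ be continuous and strictly increasing, and let $W(x)=\exp(\varphi(|x|))$, $x\in\mathbb R$. Assume that $\lim_{|t|\to\infty} t^k/W(t)=0$ for every $k\in\mathbb N$ and that $\varphi$ is regularly growing. Let $p\in[1,\infty]$. Then there exist constants $0<c\le C$ (independent of $n$) such that for all sufficiently large $n\in\mathbb N$, $$-C\int_0^1\min\Big(\varphi\Big(\frac1x\Big),\,n\Big)\,dx\;\le\;\log E_n(p,W)\;\le\;-c\int_0^1\min\Big(\varphi\Big(\frac1x\Big),\,n\Big)\,dx .$$
   Context: For $1\le p<\infty$, $\|f\|_{p,W}=\left(\int_{\mathbb R}|f(x)/W(x)|^p\,dx\right)^{1/p}$, and $\|f\|_{\infty,W}=\sup_{x\in\mathbb R}|f(x)/W(x)|$. Let $\mathcal P_{m}$ denote the space of complex polynomials of degree at most $m$. For $n\in\mathbb N$ and $p\in[1,\infty]$, $E_n(p,W)=\inf_{Q\in\mathcal P_{n-1}}\left\|\frac{1}{x-i}-Q(x)\right\|_{p,W}$. A continuous increasing $\varphi:\mathbb R_+\to\mathbb R_+$ satisfying $\int_0^\infty \frac{\varphi(t)}{1+t^2}dt=\infty$ is called normally growing if for some $A>0$ the function $\varphi(x)/x^2$ is decreasing on $[A,\infty)$ and $\varphi(x)$ is a convex function of $\log x$ on $[A,\infty)$; rapidly growing if for some $\varepsilon>0$ and $A>0$ the function $\varphi(x)/x^{1+\varepsilon}$ is increasing on $[A,\infty)$; regularly growing if it is normally or rapidly growing. *)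

(* Defs.v *)
From HB Require Import structures.
From mathcomp Require Import all_boot all_order all_algebra.
From mathcomp Require Import all_classical all_reals all_analysis.
From mathcomp Require Import complex.
Set Implicit Arguments.
Unset Strict Implicit.
Unset Printing Implicit Defensive.
Import Order.TTheory GRing.Theory Num.Theory.
Import numFieldNormedType.Exports.
Local Open Scope classical_set_scope.
Local Open Scope ring_scope.

Section Defs.
Variable R : realType.

Definition cabs (z : R[i]) : R := ComplexField.Normc.normc z.

(* ||f||_{p,W} for p in [1, +oo] (p an extended real), where the argument
   is h = |f| (nonnegative real-valued).  For finite p:
   (int_R (h x / W x)^p dx)^(1/p); for p = +oo: sup_x h x / W x. *)
Definition wnorm (p : \bar R) (W : R -> R) (h : R -> R) : \bar R :=
  match p with
  | r%:E => ((\int[@lebesgue_measure R]_(x in [set: R])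
               ((h x / W x) `^ r)%:E) `^ r^-1)%E
  | +oo%E => ereal_sup [set (h x / W x)%:E | x in [set: R]]
  | -oo%E => +oo%E
  end.

Definition E_n (n : nat) (p : \bar R) (W : R -> R) : \bar R :=
  ereal_inf [set wnorm p W (fun x : R => cabs ((x%:C - 'i)^-1 - Q.[x%:C])%C)
            | Q in [set Q : {poly R[i]} | (size Q <= n)%N]].

Definition admissible (phi : R -> R) : Prop :=
  {within `[0, +oo[, continuous phi} /\
  {in `[0, +oo[ &, {homo phi : x y / x <= y}} /\
  (\int[@lebesgue_measure R]_(t in `[0%R, +oo[%classic) (phi t / (1 + t ^+ 2))%:E
     = +oo)%E /\
  (forall t, 0 <= t -> 0 <= phi t).

Definition normally_growing (phi : R -> R) : Prop :=
  admissible phi /\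
  exists A : R, 0 < A /\
    {in `[A, +oo[ &, {homo (fun x => phi x / x ^+ 2) : x y /~ x <= y}} /\
    (forall s t l : R, ln A <= s -> ln A <= t -> 0 <= l <= 1 ->
       phi (expR (l * s + (1 - l) * t))
         <= l * phi (expR s) + (1 - l) * phi (expR t)).

Definition rapidly_growing (phi : R -> R) : Prop :=
  admissible phi /\
  exists eps A : R, 0 < eps /\ 0 < A /\
    {in `[A, +oo[ &, {homo (fun x => phi x / x `^ (1 + eps)) : x y / x <= y}}.

Definition regularly_growing (phi : R -> R) : Prop :=
  normally_growing phi \/ rapidly_growing phi.

Definition Iphi (phi : R -> R) (n : nat) : R :=
  Rintegral (@lebesgue_measure R) `[0, 1] (fun x => Num.min (phi x^-1) n%:R).

End Defs.

(* Main.v *)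
Require Import Defs.
From HB Require Import structures.
From mathcomp Require Import all_boot all_order all_algebra.
From mathcomp Require Import all_classical all_reals all_analysis.
From mathcomp Require Import measurable_realfun.
From mathcomp Require Import complex.
From mathcomp Require Import ring lra zify.
Import Order.TTheory GRing.Theory Num.Theory.
Import numFieldNormedType.Exports.
Local Open Scope classical_set_scope.
Local Open Scope ring_scope.
Set Implicit Arguments.
Unset Strict Implicit.
Unset Printing Implicit Defensive.

(* Write a_j = phi (2^j), choose J with a_J <= n <= a_{J+1} and put
   D = \sum_(j <= J) a_j / 2^j + n / 2^J.  Cutting [0, 1] dyadically gives
   D / 2 <= Iphi phi n <= D, so D replaces the integral.  With
   P = 1 - (x - i) Q, the error |1/(x - i) - Q| is |P| / |x - i| and P (i) = 1.

   Lower bound: divide P by \prod_b (1 - i x / b), with poles at -i b, b = 2^j,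
   of multiplicity about 4 a_{j+1} for j < J and 33 n for j = J.  The modulus
   of this product dominates W on [-2^J, 2^J] and, outside, the growth
   (C |x| / 2^J)^n of P given by Lagrange interpolation, while at i it is
   at most exp (C D).  The quotient is analytic in the upper half-plane, so
   its value at i is bounded by its Poisson integral, hence by the weighted norm.

   Upper bound: one needs P of degree <= n with |P|^2 <= B W on the real line
   and log |P (i)| >= c D - C.  For rapid growth D is comparable to n / 2^J and
   a Chebyshev polynomial rescaled to [-2^(J+1), 2^(J+1)] works.  For normal
   growth take \prod_j (1 - i x / 2^j)^(a_j / 160), where j runs only over the
   "peaks" of a_j / 2^j: those carry a fixed proportion of D, and away from a
   peak the contributions to log |P| decay geometrically. *)

(** * Complex modulus and real trigonometric means *)

(** All p in [1, +oo] are treated at once. For the lower bound, a weighted norm at most e is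
    replaced by a pointwise bound e (1 + k) on |f| / W, with k >= 0 of integral at most 1. For the
    upper bound, a pointwise bound M / (1 + x^2) controls every norm; this is why |P|^2 rather than
    |P| is compared with W: one square root of W pays for P, the other for the polynomial factors.
    Since k may be large at any given point, interpolation nodes cannot be prescribed: each is
    chosen in its own interval, where k is small. The peaks answer an obstacle of normal growth.
    With factors at all scales, log |P| near 2^i could exceed a_i by an unbounded factor, since a_j
    may grow like 4^j beyond i, or only linearly before i. Additive constants disappear for
    different reasons: in the upper bound because D tends to infinity, by divergence of the integral
    of phi; in the lower bound because Iphi phi n >= a_0 / 2 > 0. *)

Section ComplexModulus.
Variable R : realType.
Implicit Types z w : R[i].

Lemma cabs_ge0 z : 0 <= cabs z.
Proof. by case: z => a b; exact: sqrtr_ge0. Qed.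

Lemma cabsM z w : cabs (z * w) = cabs z * cabs w.
Proof. exact: ComplexField.Normc.normcM. Qed.

Lemma cabsV z : cabs z^-1 = (cabs z)^-1.
Proof. exact: ComplexField.Normc.normcV. Qed.

Lemma cabs0 : cabs (0 : R[i]) = 0.
Proof. exact: ComplexField.Normc.normc0. Qed.

Lemma cabs1 : cabs (1 : R[i]) = 1.
Proof. exact: ComplexField.Normc.normc1. Qed.

Lemma cabs_eq0 z : cabs z = 0 -> z = 0.
Proof. exact: ComplexField.Normc.eq0_normc. Qed.

Lemma cabsD z w : cabs (z + w) <= cabs z + cabs w.
Proof. exact: le_normcD. Qed.

Lemma cabsN z : cabs (- z) = cabs z.
Proof. exact: normcN. Qed.

Lemma cabs_real (x : R) : cabs x%:C%C = `|x|.
Proof. by rewrite /cabs /= expr0n addr0 sqrtr_sqr. Qed.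

Lemma cabsX z k : cabs (z ^+ k) = cabs z ^+ k.
Proof.
elim: k => [|k ih]; first by rewrite !expr0 cabs1.
by rewrite !exprS cabsM ih.
Qed.

Lemma cabs_prod (I : Type) (r : seq I) (P : pred I) (f : I -> R[i]) :
  cabs (\prod_(i <- r | P i) f i) = \prod_(i <- r | P i) cabs (f i).
Proof. by apply: (big_morph _ cabsM cabs1). Qed.

Lemma cabs_sum (I : Type) (r : seq I) (P : pred I) (f : I -> R[i]) :
  cabs (\sum_(i <- r | P i) f i) <= \sum_(i <- r | P i) cabs (f i).
Proof.
elim/big_ind2: _ => [|z x w y zx wy|//]; first by rewrite cabs0.
exact: le_trans (cabsD _ _) (lerD zx wy).
Qed.

Lemma Re_le_cabs z : complex.Re z <= cabs z.
Proof.
case: z => a b /=; rewrite /cabs /=.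
apply: le_trans (ler_norm a) _.
by rewrite -sqrtr_sqr ler_sqrt ?addr_ge0 ?sqr_ge0// lerDl sqr_ge0.
Qed.

Lemma ReM z w : complex.Re (z * w) =
  complex.Re z * complex.Re w - complex.Im z * complex.Im w.
Proof. by case: z; case: w. Qed.

Lemma Re_sum (I : Type) (r : seq I) (P : pred I) (f : I -> R[i]) :
  complex.Re (\sum_(i <- r | P i) f i) = \sum_(i <- r | P i) complex.Re (f i).
Proof. by apply: (big_morph (@complex.Re R)) => // -[? ?] []. Qed.

Lemma Im_sum (I : Type) (r : seq I) (P : pred I) (f : I -> R[i]) :
  complex.Im (\sum_(i <- r | P i) f i) = \sum_(i <- r | P i) complex.Im (f i).
Proof. by apply: (big_morph (@complex.Im R)) => // -[? ?] []. Qed.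

Lemma sqr_cabs z : cabs z ^+ 2 = complex.Re z ^+ 2 + complex.Im z ^+ 2.
Proof. by case: z => a b /=; rewrite sqr_sqrtr// addr_ge0 ?sqr_ge0. Qed.

Lemma cabs_rotate z : exists2 u, cabs u = 1 & u * z = (cabs z)%:C%C.
Proof.
have [->|z0] := eqVneq z 0; first by exists 1; rewrite ?cabs1 ?mulr0 ?cabs0.
have cz : cabs z != 0 by apply: contra_neq z0; exact: cabs_eq0.
exists ((cabs z)%:C%C / z); last by rewrite divfK.
by rewrite cabsM cabsV cabs_real ger0_norm ?cabs_ge0// divff.
Qed.

Lemma Re_horner_real (p : {poly R[i]}) (x : R) :
  complex.Re p.[x%:C%C] = (\poly_(k < size p) complex.Re p`_k).[x].
Proof.
rewrite horner_coef Re_sum horner_poly; apply: eq_bigr => k _.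
by rewrite -rmorphXn/= ReM /= mulr0 subr0.
Qed.

Lemma Im_horner_real (p : {poly R[i]}) (x : R) :
  complex.Im p.[x%:C%C] = (\poly_(k < size p) complex.Im p`_k).[x].
Proof.
rewrite horner_coef Im_sum horner_poly; apply: eq_bigr => k _.
by rewrite -rmorphXn; case: (p`_k) => a b /=; rewrite mulr0 add0r.
Qed.

Lemma continuous_cabs_horner (p : {poly R[i]}) :
  continuous (fun x : R => cabs p.[x%:C%C]).
Proof.
have -> : (fun x : R => cabs p.[x%:C%C]) = fun x =>
    Num.sqrt ((\poly_(k < size p) complex.Re p`_k).[x] ^+ 2
            + (\poly_(k < size p) complex.Im p`_k).[x] ^+ 2).
  apply/funext => x; rewrite -Re_horner_real -Im_horner_real -sqr_cabs.
  by rewrite sqrtr_sqr ger0_norm ?cabs_ge0.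
have sq (q : {poly R}) : continuous (fun x => q.[x] ^+ 2).
  by move=> x; apply: cvgM; exact: continuous_horner.
move=> x; apply: (@continuous_comp R R R (fun x => _ + _) (@Num.sqrt R)).
  by apply: cvgD; exact: sq.
exact: sqrt_continuous.
Qed.

Lemma cabs_sub_i (x : R) : cabs (x%:C - 'i)%C = Num.sqrt (1 + x ^+ 2).
Proof. by rewrite /cabs /= oppr0 addr0 add0r sqrrN expr1n addrC. Qed.

Lemma cabs_1Bi (y : R) : cabs (1 - 'i * y%:C)%C = Num.sqrt (1 + y ^+ 2).
Proof.
have -> : (1 - 'i * y%:C)%C = (1 -i* y)%C.
  by apply/eqP; rewrite eq_complex /=; apply/andP; split; apply/eqP; ring.
by rewrite /cabs /= sqrrN expr1n.
Qed.

Lemma sub_i_neq0 (x : R) : (x%:C - 'i)%C != 0.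
Proof. by rewrite eq_complex /= negb_and sub0r oppr_eq0 oner_eq0 orbT. Qed.

End ComplexModulus.

(** * Mean values of trigonometric polynomials in the angle [atan x] *)

Section MeanValue.
Variable R : realType.
Notation mu := (@lebesgue_measure R).

Lemma continuous_sum (I : Type) (r : seq I) (f : I -> R -> R) :
  (forall i, continuous (f i)) -> continuous (fun x => \sum_(i <- r) f i x).
Proof.
move=> cf; elim: r => [|i r ih] x.
  by under eq_fun do rewrite big_nil; exact: cvg_cst.
under eq_fun do rewrite big_cons.
apply: cvgD; [exact: cf|exact: ih].
Qed.

Lemma continuous_prod (I : Type) (r : seq I) (f : I -> R -> R) :
  (forall i, continuous (f i)) -> continuous (fun x => \prod_(i <- r) f i x).
Proof.
move=> cf; elim: r => [|i r ih] x.
  by under eq_fun do rewrite big_nil; exact: cvg_cst.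
under eq_fun do rewrite big_cons.
apply: cvgM; [exact: cf|exact: ih].
Qed.

(** The factor 2 in the frequencies makes every oscillating term pi-periodic, so its primitive takes
    equal values at both ends and only the constant term survives. *)
Lemma trig_primitive (n : nat) (c d : nat -> R) :
  exists H : R -> R,
    (forall a : R, is_derive a (1 : R) H
       (\sum_(k < n.+1) (c k * cos (k%:R * 2 * a) + d k * sin (k%:R * 2 * a)))) /\
    H (pi / 2) - H (- (pi / 2)) = pi * c 0%N.
Proof.
pose h (k : nat) (a : R) := if k == 0%N then c 0%N * a else
  (k%:R * 2)^-1 * (c k * sin (k%:R * 2 * a) - d k * cos (k%:R * 2 * a)).
exists (\sum_(k < n.+1) h k); split.
  move=> a; apply: is_derive_sum => k.
  rewrite /h; case: eqP => [->|/eqP k0].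
    rewrite !mul0r cos0 sin0 mulr0 addr0.
    by exact: is_derive_eq.
  apply: is_derive_eq.
  have k0' : (k%:R : R) != 0 by rewrite pnatr_eq0.
  rewrite /GRing.scale /= !mulr1.
  by field.
rewrite !fct_sumE -sumrB big_ord_recl big1 ?addr0.
  by rewrite /h /=; lra.
move=> k _; rewrite /h /= mulrN sinN cosN.
rewrite (_ : (bump 0 k)%:R * 2 * (pi / 2) = pi *+ (bump 0 k) :> R); last first.
  by rewrite -[pi *+ _]mulr_natr; field.
suff -> : sin (pi *+ bump 0 k) = 0 :> R by ring.
elim: (bump 0 k) => [|m ih]; first by rewrite mulr0n sin0.
by rewrite mulrS addrC sinDpi ih oppr0.
Qed.

(** In the angle [atan x] the whole line would give [pi * c 0]. Since [pi > 1], a long enough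
    bounded interval already gives [c 0]; the lost factor spares improper integrals. *)
Lemma trig_mean (n : nat) (c d : nat -> R) : 0 < c 0%N ->
  exists2 A : R, 0 < A &
    ((c 0%N)%:E <= \int[mu]_(x in `[(- A)%R, A])
      ((\sum_(k < n.+1) (c k * cos (k%:R * 2 * atan x) + d k * sin (k%:R * 2 * atan x)))
        / (1 + x ^+ 2))%:E)%E.
Proof.
move=> c0; have [H [dH Hpi]] := trig_primitive n c d.
have Hc : continuous H.
  by move=> a; apply/differentiable_continuous/derivable1_diffP; case: (dH a).
have pi1 : 1 < pi :> R by have := @pi_ge2 R; lra.
have [a a01 Ha] : exists2 a : R, 0 < a < pi / 2 & c 0%N < H a - H (- a).
  have : (fun a => H a - H (- a)) @ (pi / 2)^'- --> H (pi / 2) - H (- (pi / 2)).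
    apply: cvg_at_left_filter; apply: cvgB; first exact: Hc.
    by apply: continuous_comp; [exact: opp_continuous|exact: Hc].
  move=> /cvgr_gt /(_ (c 0%N)); rewrite Hpi ltr_pMl// => /(_ pi1) Hlt.
  near (pi / 2 : R)^'- => a.
  exists a; last by near: a.
  apply/andP; split; near: a; last exact: nbhs_left_lt.
  by apply: nbhs_left_gt; rewrite divr_gt0 ?pi_gt0.
case/andP: a01 => a0 a1.
have ta : atan (tan a) = a.
  by apply: tanK; rewrite in_itv/= a1 andbT (lt_trans _ a0)// oppr_lt0 divr_gt0 ?pi_gt0.
have A0 : 0 < tan a.
  rewrite /tan divr_gt0// ?sin_gt0_pihalf ?a0// cos_gt0_pihalf// a1 andbT.
  by rewrite (lt_trans _ a0)// oppr_lt0 divr_gt0 ?pi_gt0.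
exists (tan a) => //.
pose g x := (\sum_(k < n.+1) (c k * cos (k%:R * 2 * atan x)
  + d k * sin (k%:R * 2 * atan x))) / (1 + x ^+ 2).
under eq_integral do rewrite -[X in X%:E]/(g _).
have x2 (x : R) : 1 + x ^+ 2 != 0 by rewrite gt_eqF// ltr_pwDl ?sqr_ge0.
have dF (x : R) : is_derive x 1 (H \o atan) (g x).
  have := @is_derive1_comp R H atan x _ _ (dH (atan x)) (is_derive1_atan x).
  by [].
rewrite (@continuous_FTC2 _ g (H \o atan))/=.
- by rewrite ta atanN ta -EFinB lee_fin ltW.
- by lra.
- apply: continuous_in_subspaceT => x _.
  apply: cvgM; last first.
    apply: cvgV; first exact: x2.
    by apply: cvgD; [exact: cvg_cst|exact: exprn_continuous].
  apply: (@continuous_comp _ _ _ atan (fun a : R => \sum_(k < n.+1)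
    (c k * cos (k%:R * 2 * a) + d k * sin (k%:R * 2 * a)))); first exact: continuous_atan.
  apply: continuous_sum => {x} k x.
  apply: cvgD; apply: cvgM; try exact: cvg_cst.
    apply: continuous_comp; last exact: continuous_cos.
    by apply: cvgM; [exact: cvg_cst|exact: cvg_id].
  apply: continuous_comp; last exact: continuous_sin.
  by apply: cvgM; [exact: cvg_cst|exact: cvg_id].
- have cF : continuous (H \o atan).
    by move=> x; apply/differentiable_continuous/derivable1_diffP; case: (dF x).
  split.
  + by move=> x _; case: (dF x).
  + by apply: cvg_at_right_filter; exact: cF.
  + by apply: cvg_at_left_filter; exact: cF.
- by move=> x _; rewrite derive1E; exact: derive_val.
Unshelve. all: by end_near.
Qed.

End MeanValue.

(** * The Poisson inequality for rational functions *)

Section Poisson.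
Variable R : realType.

Let cayley_mul_i (K : fieldType) (z j : K) : z + j != 0 ->
  j * (1 + (z - j) / (z + j)) = z * (1 - (z - j) / (z + j)).
Proof. by move=> zj; field. Qed.

Let cayley_factor (K : fieldType) (z j B : K) :
  j * j + 1 = 0 -> B != 0 -> B + 1 != 0 -> z + j != 0 ->
  (1 - (z - j) / (z + j)) * (B / (B + 1)) * (1 - j * (z / B)) =
  1 - (B - 1) / (B + 1) * ((z - j) / (z + j)).
Proof.
move=> j2 B0 B1 zj.
(* The two sides differ by a multiple of [j * j + 1]; once it is displayed, the identity holds for
   arbitrary [j]. *)
transitivity (1 - (B - 1) / (B + 1) * ((z - j) / (z + j))
  - (j * j + 1) * (2 * z / ((z + j) * (B + 1)))); last by rewrite j2 mul0r subr0.
by field; rewrite B0 B1 zj.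
Qed.

Let cayley_geom (K : fieldType) (a c d t S p : K) :
  a * c * d = 1 - t -> p - 1 = (t - 1) * S -> a * (c * S) * d = 1 - p.
Proof.
move=> acd pS; transitivity (a * c * d * S); first by ring.
by rewrite acd -[1 - p]opprB pS; ring.
Qed.

Notation mu := (@lebesgue_measure R).

(** Restriction to the real line of the Cayley transform, which sends [i] to 0 and the real line
    into the unit circle; Poisson integrals at [i] become circle means. *)
Definition cayley (x : R) : R[i] := ((x%:C - 'i) / (x%:C + 'i))%C.

Lemma add_i_neq0 (x : R) : (x%:C + 'i)%C != 0.
Proof. by rewrite eq_complex /= negb_and add0r oner_eq0 orbT. Qed.

Lemma cayley_polar (x : R) :
  cayley x = (- (cos (2 * atan x) +i* sin (2 * atan x)))%C.
Proof.
apply: (canLR (mulfK (add_i_neq0 x))).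
have x1 : 0 < 1 + x ^+ 2 by rewrite ltr_pwDl ?sqr_ge0.
have c2 : cos (atan x) ^+ 2 = (1 + x ^+ 2)^-1.
  by rewrite cos_atan exprVn sqr_sqrtr// ltW.
have cn0 : cos (atan x) != 0.
  by rewrite cos_atan invr_eq0 sqrtr_eq0 -ltNge.
have sE : sin (atan x) = x * cos (atan x).
  by rewrite -[X in X * cos _]atanK /tan divfK.
have C2 : cos (2 * atan x) = (1 - x ^+ 2) / (1 + x ^+ 2).
  rewrite mulrC mulr_natr cos_mulr2n c2; field; exact: lt0r_neq0.
have S2 : sin (2 * atan x) = 2 * x / (1 + x ^+ 2).
  rewrite mulrC mulr_natr sin_mulr2n sE mulrCA -expr2 c2 -mulr_natr; field; exact: lt0r_neq0.
rewrite C2 S2; apply/eqP; rewrite eq_complex /=; apply/andP; split; apply/eqP; field;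
exact: lt0r_neq0.
Qed.

Lemma cabs_cayley (x : R) : cabs (cayley x) = 1.
Proof. by rewrite cayley_polar cabsN /cabs /= cos2Dsin2 sqrtr1. Qed.

Lemma cayley_exp (x : R) k : cayley x ^+ k =
  ((-1) ^+ k * cos (k%:R * 2 * atan x) +i* ((-1) ^+ k * sin (k%:R * 2 * atan x)))%C.
Proof.
elim: k => [|k ih]; first by rewrite !expr0 !mul0r cos0 sin0 mul1r mulr0.
rewrite exprSr ih cayley_polar.
have -> : k.+1%:R * 2 * atan x = k%:R * 2 * atan x + 2 * atan x.
  by rewrite -natr1; ring.
move: (k%:R * 2 * atan x) (2 * atan x) => s t; rewrite cosD sinD exprS.
by apply/eqP; rewrite eq_complex /=; apply/andP; split; apply/eqP; ring.
Qed.

(** After a rotation making [F.[0]] a nonnegative real, the real part of [F] on the circle is a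
    trigonometric polynomial in [2 * atan x] with constant coefficient [|F (0)|], and it stays below
    [G]. *)
Lemma poisson_disc (F : {poly R[i]}) (G : R -> R) :
  continuous G -> (forall x, cabs F.[cayley x] <= G x) ->
  exists2 A : R, 0 < A &
    ((cabs F.[0])%:E <= \int[mu]_(x in `[(- A)%R, A]) (G x / (1 + x ^+ 2))%:E)%E.
Proof.
move=> cG FG.
have x2 (x : R) : 0 < 1 + x ^+ 2 by rewrite ltr_pwDl ?sqr_ge0.
have [->|F0] := eqVneq F.[0] 0.
  exists 1 => //; rewrite cabs0; apply: integral_ge0 => x _.
  rewrite lee_fin; apply: divr_ge0; last exact: ltW.
  by apply: le_trans (FG x); exact: cabs_ge0.
have [u u1 uF] := cabs_rotate F.[0].
have c0 : 0 < cabs F.[0].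
  by rewrite lt_neqAle cabs_ge0 andbT eq_sym; apply: contra_neq F0; exact: cabs_eq0.
(* The signs come from [cayley x] being minus the unit complex number of angle [2 * atan x]. *)
pose c k : R := (-1) ^+ k * complex.Re (u * F`_k).
pose d k : R := - ((-1) ^+ k * complex.Im (u * F`_k)).
have sF : size F = (size F).-1.+1.
  by rewrite prednK// lt0n size_poly_eq0; apply: contra_neq F0 => ->; rewrite horner0.
have ReE x : complex.Re (u * F.[cayley x]) = \sum_(k < (size F).-1.+1)
    (c k * cos (k%:R * 2 * atan x) + d k * sin (k%:R * 2 * atan x)).
  rewrite -sF horner_coef mulr_sumr Re_sum; apply: eq_bigr => k _.
  by rewrite mulrA ReM cayley_exp /= /c /d; ring.
have cE : c 0%N = cabs F.[0].
  by rewrite /c mul1r -horner_coef0 uF.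
have [A A0 le1] := @trig_mean R (size F).-1 c d ltac:(by rewrite cE).
exists A => //; rewrite -cE; apply: le_trans le1 _.
have i2 : continuous (fun x : R => (1 + x ^+ 2)^-1).
  move=> x; apply: cvgV; first by rewrite gt_eqF.
  by apply: cvgD; [exact: cvg_cst|exact: exprn_continuous].
apply: le_integral => //.
- apply: continuous_compact_integrable; first exact: segment_compact.
  apply: continuous_in_subspaceT => x _; apply: cvgM; last exact: i2.
  apply: continuous_sum => k {}x; apply: cvgD; apply: cvgM; try exact: cvg_cst.
    apply: continuous_comp; last exact: continuous_cos.
    by apply: cvgM; [exact: cvg_cst|exact: continuous_atan].
  apply: continuous_comp; last exact: continuous_sin.
  by apply: cvgM; [exact: cvg_cst|exact: continuous_atan].
- apply: continuous_compact_integrable; first exact: segment_compact.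
  by apply: continuous_in_subspaceT => x _; apply: cvgM; [exact: cG|exact: i2].
- move=> x _; rewrite lee_fin ler_pM2r ?invr_gt0// -ReE.
  apply: le_trans (Re_le_cabs _) _.
  by rewrite cabsM u1 mul1r.
Qed.

Lemma prod_1Dpow_cvg (q : seq R) : all (fun x => 0 <= x < 1) q ->
  (fun m => \prod_(x <- q) (1 + x ^+ m)) @ \oo --> (1 : R).
Proof.
elim: q => [_|x q ih /= /andP[/andP[x0 x1] qs]].
  by under eq_fun do rewrite big_nil; exact: cvg_cst.
under eq_fun do rewrite big_cons.
have h1 : (fun m => 1 + x ^+ m) @ \oo --> (1 + 0 : R).
  by apply: cvgD; [exact: cvg_cst|apply: cvg_expr; rewrite ger0_norm].
have : (fun m => (1 + x ^+ m) * \prod_(y <- q) (1 + y ^+ m)) @ \oo --> ((1 + 0) * 1 : R).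
  by apply: cvgM; [exact: h1|exact: ih].
by rewrite addr0 mulr1.
Qed.

(* In the coordinate w = (x - i)/(x + i), with q = (b - 1)/(b + 1),
   1/(1 - i x/b) is a multiple of (1 - w)/(1 - q w); multiplying by
   1 - (q w)^m, which is close to 1, turns it into a polynomial in w. *)
Lemma poisson_quotient (P : {poly R[i]}) (bs : seq R) :
  (size P <= (size bs).+1)%N -> all (fun b => 1 <= b) bs ->
  exists2 A : R, 0 < A &
    ((cabs P.['i%C] / \prod_(b <- bs) (1 + b^-1))%:E <=
     \int[mu]_(x in `[(- A)%R, A])
       (2 * cabs P.[x%:C%C] / \prod_(b <- bs) Num.sqrt (1 + (x / b) ^+ 2)
          / (1 + x ^+ 2))%:E)%E.
Proof.
move=> sP bs1; pose q (b : R) := (b - 1) / (b + 1).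
have b0 b : b \in bs -> 0 < b by move=> /(allP bs1); exact: lt_le_trans.
have q01 b : b \in bs -> 0 <= q b < 1.
  move=> bb; have := allP bs1 b bb => b1; have bp := b0 _ bb.
  by rewrite /q divr_ge0 ?subr_ge0//= ?ltr_pdivrMr; lra.
(* One truncation length [m] for all geometric series: every [q b] is below 1, so the total relative
   error is at most 2, the factor 2 of the conclusion. *)
have [m m0 mle] : exists2 m, (0 < m)%N & \prod_(b <- bs) (1 + q b ^+ m) <= 2.
  have : all (fun x => 0 <= x < 1) (map q bs).
    by apply/allP => _ /mapP[b bb ->]; exact: q01.
  move=> /prod_1Dpow_cvg /cvgr_lt /(_ 2 ltac:(lra)) H.
  near \oo => m; exists m; first by near: m; exact: nbhs_infty_gt.
  rewrite -(big_map q predT (fun x => 1 + x ^+ m)) ltW//.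
  by near: m.
pose M := size bs.
(* From [x = i (1 + w) / (1 - w)], the product [P (x) (1 - w)^M] is a polynomial in [w]; the size
   bound on [P] makes [M - k] a true difference. *)
pose N : {poly R[i]} := \sum_(k < size P) P`_k *:
  (('i%C *: (1 + 'X)) ^+ k * (1 - 'X) ^+ (M - k)).
pose fac (b : R) : {poly R[i]} :=
  (b / (b + 1))%:C%C *: \sum_(l < m) ((q b)%:C%C *: 'X) ^+ l.
pose F := N * \prod_(b <- bs) fac b.
have NE x : N.[cayley x] = P.[x%:C%C] * (1 - cayley x) ^+ M.
  rewrite /N horner_sum horner_coef mulr_suml; apply: eq_bigr => k _.
  have kM : (k <= M)%N by rewrite -ltnS (leq_trans _ sP).
  rewrite hornerZ hornerM !horner_exp !hornerE.
  have -> : 'i%C * (1 + cayley x) = x%:C%C * (1 - cayley x).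
    exact/cayley_mul_i/add_i_neq0.
  rewrite exprMn -{2}(subnKC kM) exprD.
  transitivity (P`_k * (x%:C%C ^+ k * (1 - cayley x) ^+ k) * (1 - cayley x) ^+ (M - k)).
    by [].
  by rewrite !mulrA.
have facE x b : b \in bs ->
  cabs ((1 - cayley x) * (fac b).[cayley x])
   <= (1 + q b ^+ m) / Num.sqrt (1 + (x / b) ^+ 2).
  move=> bb; have bp := b0 _ bb; have q0 : 0 <= q b by case/andP: (q01 _ bb).
  rewrite ler_pdivlMr ?sqrtr_gt0 ?ltr_pwDl ?sqr_ge0//.
  have -> : Num.sqrt (1 + (x / b) ^+ 2) = cabs (1 - 'i%C * (x / b)%:C%C). by rewrite cabs_1Bi.
  rewrite -cabsM.
  have -> : (fac b).[cayley x] =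
      (b / (b + 1))%:C%C * \sum_(l < m) ((q b)%:C%C * cayley x) ^+ l.
    rewrite /fac hornerZ horner_sum; congr (_ * _); apply: eq_bigr => l _.
    by rewrite horner_exp hornerZ hornerX.
  have key : (1 - cayley x) * (b / (b + 1))%:C%C * (1 - 'i%C * (x / b)%:C%C)
      = 1 - (q b)%:C%C * cayley x.
    have j2 : ('i%C : R[i]) * 'i%C + 1 = 0 by rewrite -expr2 sqr_i addNr.
    have B0 : (b%:C)%C != 0 :> R[i] by rewrite eq_complex /= eqxx andbT gt_eqF.
    have B1 : (b%:C)%C + 1 != 0 :> R[i].
      by rewrite eq_complex /= addr0 eqxx andbT gt_eqF// ltr_pwDl.
    rewrite /cayley /q !rmorphM !fmorphV !rmorphB !rmorphD rmorph1/=.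
    exact: cayley_factor j2 B0 B1 (add_i_neq0 x).
  set S := \sum_(l < m) _.
  have -> : (1 - cayley x) * ((b / (b + 1))%:C%C * S) * (1 - 'i%C * (x / b)%:C%C)
      = 1 - ((q b)%:C%C * cayley x) ^+ m.
    exact: cayley_geom key (subrX1 _ _).
  apply: le_trans (cabsD _ _) _.
  rewrite cabsN cabs1 lerD2l cabsX cabsM cabs_cayley mulr1 cabs_real ger0_norm//.
(* At [w = 0] only the first term of each geometric sum is left, and [b / (b + 1)] is the inverse of
   [1 + b^-1]: truncation costs nothing at [i]. *)
have F0 : cabs F.[0] = cabs P.['i%C] / \prod_(b <- bs) (1 + b^-1).
  rewrite /F hornerM cabsM horner_prod cabs_prod -prodfV; congr (_ * _).
    congr cabs; rewrite /N horner_sum horner_coef; apply: eq_bigr => k _.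
    rewrite hornerZ hornerM !horner_exp hornerZ !hornerD hornerN hornerX -polyC1 !hornerC.
    by rewrite subr0 addr0 expr1n !mulr1.
  rewrite big_seq [RHS]big_seq; apply: eq_bigr => b bb.
  rewrite /fac hornerZ horner_sum cabsM cabs_real -(prednK m0) big_ord_recl.
  rewrite big1 => [|l _]; last by rewrite horner_exp hornerZ hornerX mulr0 expr0n.
  have bp := b0 _ bb.
  rewrite expr0 hornerC addr0 cabs1 mulr1 ger0_norm ?divr_ge0//; try lra.
  field; apply/andP; split; lra.
rewrite -F0; apply: poisson_disc.
  move=> x; apply: cvgM.
    by apply: cvgM; [exact: cvg_cst|exact: continuous_cabs_horner].
  apply: cvgV.
    rewrite gt_eqF// prodr_gt0// => b _; rewrite sqrtr_gt0 ltr_pwDl ?sqr_ge0//.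
  apply: continuous_prod => b {}x.
  apply: (@continuous_comp R R R (fun x => 1 + (x / b) ^+ 2) (@Num.sqrt R));
    last exact: sqrt_continuous.
  apply: cvgD; first exact: cvg_cst.
  by apply: cvgM; apply: cvgM; (exact: cvg_id || exact: cvg_cst).
move=> x.
have -> : F.[cayley x] = P.[x%:C%C] * \prod_(b <- bs) ((1 - cayley x) * (fac b).[cayley x]).
  rewrite /F hornerM NE horner_prod big_split/= -mulrA; congr (_ * (_ * _)).
  by rewrite big_const_seq count_predT iter_mulr_1.
rewrite cabsM cabs_prod -mulrA mulrCA ler_wpM2l ?cabs_ge0//.
apply: (@le_trans _ _ (\prod_(b <- bs) (1 + q b ^+ m) / \prod_(b <- bs) Num.sqrt (1 + (x / b) ^+ 2))).
  rewrite -prodfV -big_split/= big_seq [leRHS]big_seq; apply: ler_prod => b bb.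
  by rewrite cabs_ge0 facE.
rewrite ler_pM2r// invr_gt0 prodr_gt0// => b _.
by rewrite sqrtr_gt0 ltr_pwDl ?sqr_ge0.
Unshelve. all: by end_near.
Qed.
End Poisson.

(** * Growth of polynomials outside an interval *)

Section Growth.
Variable R : realType.

(** These are the Lagrange denominators at the integer nodes 0, ..., n; their inverses are binomial
    coefficients over [n!], hence easy to sum. *)
Lemma prod_dist_fact (n k : nat) : (k <= n)%N ->
  \prod_(l < n.+1 | l != k :> nat) `|k%:R - l%:R| = (k`! * (n - k)`!)%:R :> R.
Proof.
have base m : \prod_(l < m) `|m%:R - l%:R| = (m`!)%:R :> R.
  elim: m => [|m ih]; first by rewrite big_ord0.
  rewrite big_ord_recl subr0 ger0_norm ?ler0n// factS natrM -ih; congr (_ * _).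
  by apply: eq_bigr => l _; rewrite lift0 -[m.+1%:R]natr1 -[l.+1%:R]natr1 opprD addrACA subrr addr0.
elim: n => [|n ih]; first by rewrite leqn0 => /eqP ->; rewrite big_mkcond big_ord_recr big_ord0 /= mulr1.
rewrite leq_eqVlt => /orP[/eqP ->|].
  rewrite big_mkcond big_ord_recr /= eqxx mulr1 subnn fact0 muln1 -base.
  by apply: eq_bigr => l _; rewrite neq_ltn ltn_ord.
rewrite ltnS => kn; rewrite big_mkcond big_ord_recr /= -big_mkcond/= ih//.
rewrite gtn_eqF ?ltnS//= subSn// factS distrC ger0_norm ?subr_ge0 ?ler_nat ?leqW//.
by rewrite -natrB ?leqW// subSn// -natrM; congr (_%:R); lia.
Qed.

Lemma expR1_le4 : expR 1 <= 4 :> R.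
Proof.
have -> : expR 1 = expR 2^-1 * expR 2^-1 :> R by rewrite -expRD (_ : 2^-1 + 2^-1 = 1 :> R)//; lra.
have e0 : 0 < expR 2^-1 :> R by exact: expR_gt0.
have e1 : expR 2^-1 * expR (- 2^-1) = 1 :> R by rewrite -expRD subrr expR0.
have := ler_wpM2l (ltW e0) (@expR_ge1Dx R (- 2^-1)); rewrite e1.
by move: (expR 2^-1) e0 => e e0 h; have : e <= 2; [lra|nra].
Qed.

(** A crude Stirling bound; the induction step is [(1 + 1/n)^n <= e <= 4]. *)
Lemma expn_le_fact (n : nat) : n%:R ^+ n <= 4 ^+ n * (n`!)%:R :> R.
Proof.
elim: n => [|n ih]; first by rewrite !expr0 mulr1.
have [->|n0] := posnP n; first by rewrite !expr1 (_ : 1`! = 1)%N//; lra.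
have np : 0 < n%:R :> R by rewrite ltr0n.
have e4 := expR1_le4.
have step : n.+1%:R ^+ n <= 4 * n%:R ^+ n :> R.
  rewrite -ler_pdivrMr ?exprn_gt0// -expr_div_n; apply: le_trans e4.
  have -> : expR 1 = expR (n%:R^-1) ^+ n :> R.
    by rewrite -expRM_natl divff ?gt_eqF.
  apply: lerXn2r; rewrite ?nnegrE ?divr_ge0 ?expR_ge0//.
  rewrite -natr1 mulrDl divff ?gt_eqF// mul1r; exact: expR_ge1Dx.
rewrite exprS factS natrM exprS mulrACA [4 * _]mulrC -mulrA ler_wpM2l//.
by apply: le_trans step _; rewrite ler_wpM2l.
Qed.

Lemma lagrange_interpolation (K : fieldType) (n : nat) (P : {poly K}) (a : nat -> K) :
  (size P <= n.+1)%N -> {in [pred k | (k <= n)%N] &, injective a} ->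
  P = \sum_(k < n.+1) P.[a k] *:
        \prod_(l < n.+1 | l != k :> nat) ((a k - a l)^-1 *: ('X - (a l)%:P)).
Proof.
move=> sP inja; apply/eqP; rewrite -subr_eq0; apply/eqP.
apply: (@roots_geq_poly_eq0 _ _ [seq a k | k <- iota 0 n.+1]).
- apply/allP => _ /mapP[k + ->]; rewrite mem_iota add0n ltnS => kn.
  rewrite rootE hornerD hornerN horner_sum (bigD1 (Ordinal (kn : (k < n.+1)%N)))//=.
  rewrite [X in _ - (_ + X)]big1 ?addr0 => [|j jk].
    rewrite hornerZ horner_prod big1 ?mulr1 ?subrr// => l lk.
    rewrite !hornerE mulVf// subr_eq0; apply: contra lk => /eqP/inja akl.
    by rewrite eq_sym akl// inE -ltnS ltn_ord.
  rewrite hornerZ horner_prod (bigD1 (Ordinal (kn : (k < n.+1)%N)))/=.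
    by rewrite hornerZ hornerXsubC subrr !(mulr0, mul0r).
  by rewrite eq_sym; apply: contra jk => /eqP jk; apply/eqP/val_inj.
- rewrite map_inj_in_uniq ?iota_uniq// => k l.
  by rewrite !mem_iota !add0n !ltnS => kn ln; apply: inja.
- rewrite size_map size_iota; apply: leq_trans (size_polyD _ _) _.
  rewrite size_polyN geq_max sP; apply: leq_trans (size_sum _ _ _) _.
  apply/bigmax_leqP => k _; apply: leq_trans (size_scale_leq _ _) _.
  apply: leq_trans (size_prod_leq _ _) _.
  rewrite leq_subLR -add1n; apply: (@leq_trans (\sum_(l < n.+1 | l != k :> nat) 2).+1).
    rewrite ltnS; apply: leq_sum => l _; apply: leq_trans (size_scale_leq _ _) _.
    by rewrite size_XsubC.
  rewrite sum_nat_const.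
  have -> : #|[pred l : 'I_n.+1 | l != k :> nat]| = n.
    have := cardC1 k; rewrite card_ord /= => E; rewrite -[RHS]E; apply: eq_card => l.
    by rewrite !inE.
  by lia.
Qed.

(** The nodes are free inside separated intervals, yet their distances are at least [s * |k - l|],
    so the Lagrange denominators compare with those of integer nodes. Each numerator factor is at
    most [2 |x|], and summing binomials gives [M (4 |x| / s)^n / n!]. *)
Lemma growth_outside (n : nat) (P : {poly R[i]}) (a : nat -> R) (s M x : R) :
  (size P <= n.+1)%N -> 0 < s ->
  (forall k, (k <= n)%N -> 2 * k%:R * s <= a k <= (2 * k%:R + 1) * s) ->
  (forall k, (k <= n)%N -> cabs P.[(a k)%:C%C] <= M) ->
  (2 * n%:R + 1) * s <= `|x| ->
  cabs P.[x%:C%C] <= M * (48 * `|x| / ((2 * n%:R + 1) * s)) ^+ n.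
Proof.
move=> sP s0 ha hM hx.
have M0 : 0 <= M by apply: le_trans (hM 0%N _) => //; exact: cabs_ge0.
have dist k l : (k <= n)%N -> (l <= n)%N -> s * `|k%:R - l%:R| <= `|a k - a l|.
  move=> kn ln; wlog kl : k l kn ln / (l <= k)%N.
    move=> H; case/orP: (leq_total l k) => ?; first exact: H.
    by rewrite distrC [`|a _ - _|]distrC; exact: H.
  move: kl; rewrite leq_eqVlt => /orP[/eqP ->|lk].
    by rewrite !subrr normr0 mulr0.
  have lk1 : l%:R + 1 <= k%:R :> R by rewrite natr1 ler_nat.
  rewrite ger0_norm; last lra.
  have /andP[h1 h2] := ha _ kn; have /andP[h3 h4] := ha _ ln.
  rewrite ger0_norm; nra.
have inj : {in [pred k | (k <= n)%N] &, injective (fun k => (a k)%:C%C)}.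
  move=> k l; rewrite !inE => kn ln [akl].
  have := dist _ _ kn ln; rewrite akl subrr normr0.
  rewrite pmulr_rle0// normr_le0 subr_eq0 eqr_nat => /eqP; exact.
rewrite {1}(lagrange_interpolation sP inj) horner_sum.
apply: le_trans (cabs_sum _ _ _) _.
have xp : 0 < `|x| by apply: lt_le_trans hx; rewrite mulr_gt0// ltr_wpDl// mulr_ge0.
have term (k : 'I_n.+1) : cabs (P.[(a k)%:C%C] *:
     \prod_(l < n.+1 | l != k :> nat)
       (((a k)%:C%C - (a l)%:C%C)^-1 *: ('X - (a l)%:C%C%:P))).[x%:C%C]
    <= M * (2 * `|x| / s) ^+ n / (n`!)%:R * 'C(n, k)%:R.
  have kn : (k <= n)%N by rewrite -ltnS.
  rewrite hornerZ cabsM -!mulrA ler_pM ?cabs_ge0//; first exact: hM.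
  rewrite horner_prod cabs_prod.
  apply: (@le_trans _ _ (\prod_(l < n.+1 | l != k :> nat)
      ((2 * `|x| / s) * `|k%:R - l%:R|^-1))).
    apply: ler_prod => l lk; rewrite cabs_ge0/=.
    have ln : (l <= n)%N by rewrite -ltnS.
    rewrite hornerZ hornerXsubC -!rmorphB cabsM cabsV !cabs_real.
    have d0 : 0 < `|k%:R - l%:R| :> R.
      by rewrite normr_gt0 subr_eq0 eqr_nat eq_sym.
    rewrite mulrC -mulrA -invfM; apply: ler_pM; rewrite ?invr_ge0//.
      have /andP[h1 h2] := ha _ ln.
      have : a l <= `|x|.
        apply: le_trans h2 _; apply: le_trans hx.
        by rewrite ler_pM2r// lerD2r ler_pM2l// ler_nat.
      have : 0 <= a l by apply: le_trans h1; rewrite mulr_ge0 ?(ltW s0)// mulr_ge0.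
      move=> al0 alx; apply: le_trans (ler_normB _ _) _.
      rewrite (ger0_norm al0); lra.
    rewrite lef_pV2 ?posrE ?mulr_gt0//; first exact: dist.
    by apply: lt_le_trans (dist _ _ kn ln); rewrite mulr_gt0.
  rewrite big_split/= prodfV prod_dist_fact// prodr_const.
  have -> : #|[pred l : 'I_n.+1 | l != k :> nat]| = n.
    have := cardC1 k; rewrite card_ord /= => E; rewrite -[RHS]E; apply: eq_card => l.
    by rewrite !inE.
  rewrite -(bin_fact kn) -[2 * `|x| / s]mulrA.
  have c0 : 'C(n, k)%:R != 0 :> R by rewrite pnatr_eq0 -lt0n bin_gt0.
  rewrite [X in _ * X <= _](_ : _ = ('C(n, k) * (k`! * (n - k)`!))%:R^-1 * 'C(n, k)%:R)//.
  by rewrite !natrM; field; rewrite c0 !pnatr_eq0 -!lt0n !fact_gt0.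
apply: le_trans (ler_sum _ (fun k _ => term k)) _.
have sum_bin : (\sum_(k < n.+1) 'C(n, k) = 2 ^ n)%N.
  by rewrite -[2%N]/(1 + 1)%N expnDn; apply: eq_bigr => i _; rewrite !exp1n !muln1.
rewrite -mulr_sumr -natr_sum sum_bin.
rewrite -!mulrA ler_wpM2l//.
have fp : 0 < (n`!)%:R :> R by rewrite ltr0n fact_gt0.
rewrite mulrCA ler_pdivrMl// natrX -exprMn.
have [->|n0] := posnP n; first by rewrite !expr0 fact0 mulr1.
have np : 0 < n%:R :> R by rewrite ltr0n.
have np1 : 1 <= n%:R :> R by rewrite ler1n.
(* For [n >= 1], [4 <= 12 n / (2 n + 1)]; the factor [n^n] thus created is at most [4^n n!], whence
   48 = 12 * 4. *)
apply: (@le_trans _ _ ((12 * `|x| / ((2 * n%:R + 1) * s)) ^+ n * n%:R ^+ n)).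
  rewrite -exprMn; apply: lerXn2r;
    rewrite ?nnegrE ?mulr_ge0 ?divr_ge0 ?invr_ge0 ?mulr_ge0 ?(ltW s0) ?addr_ge0//.
  have -> : 12 * `|x| / ((2 * n%:R + 1) * s) * n%:R = 2 * (`|x| / s) * (6 * n%:R / (2 * n%:R + 1)).
    by field; apply/andP; split; rewrite gt_eqF//; lra.
  rewrite -!mulrA ler_wpM2l// ler_wpM2l// ler_wpM2l ?invr_ge0 ?(ltW s0)//.
  rewrite mulrA ler_pdivlMr; lra.
apply: le_trans (ler_wpM2l _ (expn_le_fact n)) _.
  by rewrite exprn_ge0// divr_ge0 ?mulr_ge0 ?addr_ge0 ?(ltW s0)// mulr_ge0.
have -> : 48 * (`|x| / ((2 * n%:R + 1) * s)) = 12 * `|x| / ((2 * n%:R + 1) * s) * 4.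
  by ring.
by rewrite [in leRHS]exprMn [leRHS]mulrCA [4 ^+ n * _]mulrC.
Qed.

End Growth.

(** * Peaks of a dyadic sequence *)

Section Peaks.
Variable R : realType.

Lemma sum_geo_le (q c : R) n : 0 <= q < 1 -> 1 <= c * (1 - q) ->
  \sum_(l < n) q ^+ l <= c.
Proof.
case/andP=> q0 q1 c1; rewrite -(@ler_pM2r _ (1 - q)) ?subr_gt0//.
apply: le_trans c1; rewrite mulrC -opprB mulNr -subrX1 opprB gerBl; exact: exprn_ge0.
Qed.

Lemma sum_geo_nat_le n : \sum_(l < n) l.+1%:R * (3 / 4) ^+ l <= 16 :> R.
Proof.
suff : \sum_(l < n) l.+1%:R * (3 / 4) ^+ l = 16 - (4 * n%:R + 16) * (3 / 4) ^+ n :> R.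
  move=> ->; rewrite gerBl mulr_ge0 ?exprn_ge0 ?addr_ge0 ?mulr_ge0 ?divr_ge0//.
elim: n => [|n ih]; first by rewrite big_ord0 expr0; lra.
rewrite big_ord_recr /= ih exprS -[n.+1%:R]natr1.
by move: ((3 / 4) ^+ n) => z; field.
Qed.

(** With [b_k = a_k / 2^k], both conditions read [b_k <= (3/2)^|j - k| b_j]. What matters later is
    that 3/4 < 1 on the left and 3 < 4 on the right. *)
Definition peak (a : nat -> R) (J : nat) (j : nat) : bool :=
  [&& (j <= J)%N,
      [forall k : 'I_j, a k <= (3 / 4) ^+ (j - k) * a j] &
      [forall k : 'I_J.+1, (j <= k)%N ==> (a k <= 3 ^+ (k - j) * a j)]].

Lemma peakP (a : nat -> R) (J j : nat) : peak a J j ->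
  [/\ (j <= J)%N,
      forall k, (k <= j)%N -> a k <= (3 / 4) ^+ (j - k) * a j &
      forall k, (j <= k <= J)%N -> a k <= 3 ^+ (k - j) * a j].
Proof.
case/and3P=> jJ /forallP h1 /forallP h2; split=> // k.
  rewrite leq_eqVlt => /orP[/eqP ->|kj]; first by rewrite subnn expr0 mul1r.
  exact: (h1 (Ordinal kj)).
case/andP=> jk kJ; rewrite -ltnS in kJ.
by have := h2 (Ordinal kJ); rewrite /= jk.
Qed.

Let unscale_down (x y : R) (l d : nat) :
  (2 / 3) ^+ d * (x / 2 ^+ l) <= y / 2 ^+ (l + d) -> x <= (3 / 4) ^+ d * y.
Proof.
have -> : 3 / 4 = (2 / 3 * 2)^-1 :> R by field.
have : 0 < 2 / 3 :> R by rewrite divr_gt0.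
move: (2 / 3) => q q0; rewrite exprVn exprMn exprD.
have u0 : 0 < 2 ^+ l :> R by rewrite exprn_gt0.
have v0 : 0 < 2 ^+ d :> R by rewrite exprn_gt0.
have t0 : 0 < q ^+ d :> R by rewrite exprn_gt0.
move: (2 ^+ l) (2 ^+ d) (q ^+ d) u0 v0 t0 => u v t u0 v0 t0.
rewrite mulrA ler_pdivrMr// ler_pdivlMl ?mulr_gt0//.
rewrite (_ : y / (u * v) * u = y / v); last by field; rewrite !gt_eqF.
by rewrite ler_pdivlMr// => h; lra.
Qed.

Let unscale_up (x y : R) (k d : nat) :
  (2 / 3) ^+ d * (x / 2 ^+ (k + d)) <= y / 2 ^+ k -> x <= 3 ^+ d * y.
Proof.
have -> : 3 ^+ d = 2 ^+ d / (2 / 3) ^+ d :> R by rewrite -expr_div_n; congr (_ ^+ _); field.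
have : 0 < 2 / 3 :> R by rewrite divr_gt0.
move: (2 / 3) => q q0; rewrite exprD.
have u0 : 0 < 2 ^+ k :> R by rewrite exprn_gt0.
have v0 : 0 < 2 ^+ d :> R by rewrite exprn_gt0.
have t0 : 0 < q ^+ d :> R by rewrite exprn_gt0.
move: (2 ^+ k) (2 ^+ d) (q ^+ d) u0 v0 t0 => u v t u0 v0 t0.
rewrite mulrA ler_pdivrMr ?mulr_gt0//.
rewrite (_ : y / u * (u * v) = v * y); last by field; rewrite gt_eqF.
by move=> h; rewrite [leRHS]mulrAC ler_pdivlMr//; lra.
Qed.

(* b_j = a_j / 2^j; a peak k maximizes (2/3)^|j - k| b_k for some j. *)
Lemma peak_dominates (a : nat -> R) (J : nat) : (forall j, 0 <= a j) ->
  forall j, (j <= J)%N -> exists2 k, peak a J k &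
    a j / 2 ^+ j <= (2 / 3) ^+ `|j - k| * (a k / 2 ^+ k).
Proof.
move=> a0 j jJ; pose f (k : 'I_J.+1) : R := (2 / 3) ^+ `|j - k| * (a k / 2 ^+ k).
have [k _ kmax] := @Order.TotalTheory.arg_maxP _ _ _ (Ordinal (jJ : (j < J.+1)%N)) predT f isT.
(* The triangle inequality [|j - l| <= |j - k| + |k - l|] turns maximality weighted around [j] into
   maximality weighted around [k]. *)
have shift (l : nat) : (l <= J)%N -> (2 / 3) ^+ `|k - l| * (a l / 2 ^+ l) <= a k / 2 ^+ k.
  rewrite -ltnS => lJ; have := kmax (Ordinal lJ) isT; rewrite /f/= => h.
  have p0 : 0 < (2 / 3) ^+ `|j - k| :> R by rewrite exprn_gt0// divr_gt0.
  rewrite -(ler_pM2l p0); apply: le_trans h; rewrite mulrA -exprD.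
  rewrite ler_wpM2r ?divr_ge0 ?exprn_ge0//.
  by apply: ler_wiXn2l; [rewrite divr_ge0|rewrite ler_pdivrMr//; lra|lia].
have kJ : (k <= J)%N by rewrite -ltnS.
exists k; last first.
  have := kmax (Ordinal (jJ : (j < J.+1)%N)) isT.
  by rewrite /f /= distnn expr0 mul1r.
apply/and3P; split=> //; apply/forallP => l.
  have lk := ltn_ord l.
  have := shift l (leq_trans (ltnW lk) kJ).
  have -> : `|k - l|%N = (k - l)%N by lia.
  by move=> h; apply: (@unscale_down (a l) (a k) l); rewrite subnKC ?(ltnW lk).
apply/implyP => kl; have lJ : (l <= J)%N by rewrite -ltnS.
have := shift l lJ; have -> : `|k - l|%N = (l - k)%N by lia.
by move=> h; apply: (@unscale_up (a l) (a k) k); rewrite subnKC.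
Qed.

Lemma sum_dist_le (J k : nat) : (k <= J)%N ->
  \sum_(j < J.+1) (2 / 3) ^+ `|j - k| <= 6 :> R.
Proof.
move=> kJ; rewrite (bigID (fun j : 'I_J.+1 => j < k.+1)%N)/=.
have le3 n : \sum_(l < n) (2 / 3) ^+ l <= 3 :> R.
  by apply: sum_geo_le; [apply/andP; split|]; lra.
have -> : 6 = 3 + 3 :> R by lra.
apply: lerD.
  rewrite -(big_ord_widen J.+1 (fun j => (2 / 3) ^+ `|j - k| : R))//.
  rewrite (reindex_inj rev_ord_inj)/=; apply: le_trans (le3 k.+1).
  by apply: ler_sum => l _; have -> : `|k.+1 - l.+1 - k|%N = l by have := ltn_ord l; lia.
under eq_bigl => j do rewrite -leqNgt.
rewrite -(big_geq_mkord k.+1 J.+1 predT (fun j => (2 / 3) ^+ `|j - k| : R)).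
rewrite -{1}[k.+1]add0n big_addn big_mkord; apply: le_trans (le3 (J.+1 - k.+1)%N).
apply: ler_sum => l _; apply: ler_wiXn2l; try lra; lia.
Qed.

(** Every term is charged to a peak with a factor geometric in the distance; after exchanging the
    sums, a peak is charged at most 6 times its own value. *)
Lemma peaks_mass (a : nat -> R) (J : nat) : (forall j, 0 <= a j) ->
  \sum_(j < J.+1) a j / 2 ^+ j <= 6 * \sum_(j < J.+1 | peak a J j) a j / 2 ^+ j.
Proof.
move=> a0; have b0 j : 0 <= a j / 2 ^+ j by rewrite divr_ge0 ?exprn_ge0.
apply: (@le_trans _ _ (\sum_(j < J.+1) \sum_(k < J.+1 | peak a J k)
    (2 / 3) ^+ `|j - k| * (a k / 2 ^+ k))).
  apply: ler_sum => j _; have jJ : (j <= J)%N by rewrite -ltnS.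
  have [k pk le] := peak_dominates a0 jJ; apply: le_trans le _.
  have kJ : (k < J.+1)%N by rewrite ltnS; case/peakP: pk.
  rewrite (bigD1 (Ordinal kJ))//= lerDl; apply: sumr_ge0 => l _.
  by rewrite mulr_ge0// exprn_ge0// divr_ge0.
rewrite exchange_big/= mulr_sumr; apply: ler_sum => k _.
by rewrite -mulr_suml ler_wpM2r// sum_dist_le// -ltnS.
Qed.

(** * Peaks of convex sequences of ratio at most 4 *)

Section Growth.
Variable a : nat -> R.
Hypothesis a0 : forall j, 0 <= a j.
Hypothesis a4 : forall j, a j.+1 <= 4 * a j.
Hypothesis a_convex : forall j, a j.+1 - a j <= a j.+2 - a j.+1.

Let slope_mono i j : (i <= j)%N -> a i.+1 - a i <= a j.+1 - a j.
Proof.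
move=> ij; rewrite -(subnKC ij); elim: (j - i)%N => [|d ih]; first by rewrite addn0.
by rewrite addnS; apply: le_trans ih _; exact: a_convex.
Qed.

Let above_tangent j d : a j.+1 + d%:R * (a j.+1 - a j) <= a (j.+1 + d).
Proof.
elim: d => [|d ih]; first by rewrite mul0r addr0 addn0.
rewrite addnS -natr1 mulrDl mul1r addrA.
have := @slope_mono j (j.+1 + d)%N ltac:(lia); lra.
Qed.

Let growth4 j d : a (j + d) <= 4 ^+ d * a j.
Proof.
elim: d => [|d ih]; first by rewrite addn0 expr0 mul1r.
rewrite addnS exprS -mulrA; apply: le_trans (a4 _) _.
by rewrite ler_pM2l.
Qed.

(** Let [j] be the largest peak up to [i]. Earlier peaks decay like [(3/4)^(j - k) a_j], so the sum
    is of order [(1 + i - j) a_j]. Being a positive peak, [j] has [a_j - a_(j-1) >= a_j / 4]; by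
    convexity this slope persists up to [i], and [a_i] pays for the factor [i - j]. This is where
    index 0 has to be excluded. *)
Let peak_left J i : \sum_(j < J.+1 | peak a J j && (0 < j)%N && (j <= i)%N)
  a j * (2 * (i - j).+1%:R) <= 64 * a i.
Proof.
pose P j := peak a J j && (0 < j)%N && (j <= i)%N.
have [ex|nex] := pselect (exists j, P j); last first.
  rewrite big1 ?mulr_ge0// => j Pj; case: nex; by exists (j : nat).
have [//|j /andP[/andP[pj j0] ji] jmax] := @ex_maxnP P i ex _.
  by move=> j /andP[].
have [jJ left _] := peakP pj.
apply: (@le_trans _ _ (\sum_(k < j.+1) (3 / 4) ^+ (j - k) * a j * (2 * (i - k).+1%:R))).
  rewrite (big_ord_widen J.+1 (fun k => (3 / 4) ^+ (j - k) * a j * (2 * (i - k).+1%:R)))//.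
  rewrite big_mkcond [leRHS]big_mkcond/=; apply: ler_sum => k _.
  case: ifPn => [Pk|_].
    have kj : (k <= j)%N by exact: jmax.
    by rewrite ltnS kj ler_wpM2r ?mulr_ge0// left.
  by case: ifP => // _; rewrite !mulr_ge0// exprn_ge0// divr_ge0.
rewrite (reindex_inj rev_ord_inj)/=.
under eq_bigr => l _.
  have lj : (l <= j)%N by rewrite -ltnS.
  have -> : (j - (j.+1 - l.+1) = l)%N by lia.
  have -> : ((i - (j.+1 - l.+1)).+1 = l.+1 + (i - j))%N by lia.
  rewrite natrD (_ : _ * _ = (2 * a j) * (l.+1%:R * (3 / 4) ^+ l)
    + 2 * (i - j)%:R * a j * (3 / 4) ^+ l); last by ring.
  over.
rewrite big_split/= -!mulr_sumr.
have aj0 := a0 j; have d0 : 0 <= (i - j)%:R :> R by [].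
have S1 := ler_wpM2l (mulr_ge0 (ler0n R 2) aj0) (sum_geo_nat_le j.+1).
have S2 : \sum_(l < j.+1) (3 / 4) ^+ l <= 4 :> R.
  by apply: sum_geo_le; [apply/andP; split|]; lra.
have S3 := ler_wpM2l (mulr_ge0 (mulr_ge0 (ler0n R 2) d0) aj0) S2.
have slope : a j.-1 <= 3 / 4 * a j.
  by have := left j.-1 (leq_pred _); rewrite (_ : (j - j.-1 = 1)%N) ?expr1//; lia.
have := above_tangent j.-1 (i - j); rewrite prednK// subnKC// => tang.
have := ler_wpM2l d0 slope.
have : 0 <= (i - j)%:R * a j by rewrite mulr_ge0.
lra.
Qed.

(** Let [j] be the smallest peak beyond [i]. Up to [j] the ratio is at most 4, and peaks beyond grow
    at ratio at most 3, so the weights in powers of 1/4 leave a geometric series of ratio 3/4. *)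
Let peak_right J i : \sum_(j < J.+1 | peak a J j && (i < j)%N)
  a j * (4 * (1 / 4) ^+ (j - i)) <= 16 * a i.
Proof.
pose P j := peak a J j && (i < j)%N.
have [ex|nex] := pselect (exists j, P j); last first.
  rewrite big1 ?mulr_ge0// => j Pj; case: nex; by exists (j : nat).
have [j /andP[pj ij] jmin] := @ex_minnP P ex.
have [jJ _ right] := peakP pj.
have aj : a j <= 4 ^+ (j - i) * a i.
  by have := growth4 i (j - i); rewrite subnKC// ltnW.
have S2 n : \sum_(l < n) (3 / 4) ^+ l <= 4 :> R.
  by apply: sum_geo_le; [apply/andP; split|]; lra.
apply: (@le_trans _ _ (\sum_(k < J.+1 | (j <= k)%N) 4 * a i * (3 / 4) ^+ (k - j))).
  rewrite big_mkcond [leRHS]big_mkcond/=; apply: ler_sum => k _.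
  case: ifPn => [Pk|_]; last by case: ifP => // _; rewrite !mulr_ge0// exprn_ge0// divr_ge0.
  have jk : (j <= k)%N by exact: jmin.
  have kJ : (k <= J)%N by rewrite -ltnS.
  rewrite jk; have := right k ltac:(by rewrite jk).
  have -> : (k - i = (k - j) + (j - i))%N by lia.
  set d := (k - j)%N; set e := (j - i)%N in aj * => ak.
  have q1 : 0 <= 3 ^+ d :> R by rewrite exprn_ge0.
  have q2 : 0 <= 4 * (1 / 4) ^+ (d + e) :> R by rewrite mulr_ge0// exprn_ge0// divr_ge0.
  have := ler_wpM2r q2 (le_trans ak (ler_wpM2l q1 aj)).
  move/le_trans; apply; rewrite le_eqVlt; apply/orP; left; apply/eqP.
  have E1 : 3 ^+ d * (1 / 4) ^+ d = (3 / 4) ^+ d :> R by rewrite -exprMn; congr (_ ^+ _); field.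
  have E2 : 4 ^+ e * (1 / 4) ^+ e = 1 :> R.
    by rewrite -exprMn (_ : 4 * (1 / 4) = 1) ?expr1n//; field.
  rewrite exprD.
  transitivity (4 * a i * (3 ^+ d * (1 / 4) ^+ d) * (4 ^+ e * (1 / 4) ^+ e)).
    by move: (3 ^+ d) ((1 / 4) ^+ d) (4 ^+ e) ((1 / 4) ^+ e) => x y z t; ring.
  by rewrite E1 E2 mulr1.
rewrite -mulr_sumr -(big_geq_mkord j J.+1 predT (fun k => (3 / 4) ^+ (k - j) : R)).
rewrite -{1}[j]add0n big_addn big_mkord.
under eq_bigr do rewrite addnK.
have := ler_wpM2l (mulr_ge0 (ler0n R 4) (a0 i)) (S2 (J.+1 - j)%N); lra.
Qed.

(** The weights dominate [log |1 - i x / 2^j|] for [|x| <= 2^(i+1)]: linear in [i - j] once [|x|]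
    has passed the scale [2^j], quadratically small before. Multiplicities proportional to [a_j] at
    peaks thus keep [log |P|] of order [a_i]. *)
Lemma peaks_growth J i : \sum_(j < J.+1 | peak a J j && (0 < j)%N)
  a j * (if (j <= i)%N then 2 * (i - j).+1%:R else 4 * (1 / 4) ^+ (j - i))
  <= 80 * a i.
Proof.
rewrite (bigID (fun j : 'I_J.+1 => (j <= i)%N))/=.
have -> : 80 * a i = 64 * a i + 16 * a i by ring.
apply: lerD.
  under eq_bigr => j /andP[_ ji] do rewrite ji.
  exact: peak_left.
apply: le_trans (peak_right J i).
under eq_bigr => j /andP[_ ji] do rewrite (negbTE ji).
rewrite [leLHS]big_mkcond [leRHS]big_mkcond/=; apply: ler_sum => j _.
rewrite -ltnNge; case: ifPn => [/andP[/andP[-> _] ->]//|_]; case: ifP => // _.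
by rewrite !mulr_ge0// exprn_ge0// divr_ge0.
Qed.

End Growth.
End Peaks.

(** * Chebyshev polynomials *)

Section Chebyshev.

(** Two consecutive Chebyshev polynomials of the first kind; carrying the pair makes the three-term
    recurrence structural. *)
Fixpoint chebyshev2 (K : fieldType) (m : nat) : {poly K} * {poly K} :=
  if m is k.+1 then
    let: (p, q) := chebyshev2 K k in (q, 2%:R *: ('X * q) - p)
  else (1, 'X).

Definition chebyshev (K : fieldType) m : {poly K} := (chebyshev2 K m).1.

Lemma chebyshevSS (K : fieldType) m :
  chebyshev K m.+2 = 2%:R *: ('X * chebyshev K m.+1) - chebyshev K m.
Proof. by rewrite /chebyshev /=; case: (chebyshev2 K m). Qed.

Lemma size_chebyshev (K : fieldType) m : (size (chebyshev K m) <= m.+1)%N.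
Proof.
have [] : (size (chebyshev K m) <= m.+1 /\ size (chebyshev K m.+1) <= m.+2)%N; last by [].
elim: m => [|m [ih1 ih2]]; first by rewrite /chebyshev /= size_poly1 size_polyX.
split=> //; rewrite chebyshevSS; apply: leq_trans (size_polyD _ _) _.
rewrite size_polyN geq_max (leq_trans ih1) ?andbT; last by lia.
apply: leq_trans (size_scale_leq _ _) _.
by rewrite mulrC; apply: leq_trans (size_polyMleq _ _) _; rewrite size_polyX; lia.
Qed.

(** Used twice: [w] on the unit circle bounds the polynomial on [-1, 1], and [w] on the imaginary
    axis evaluates it at [i y]. *)
Lemma chebyshev_joukowski (K : fieldType) m (w : K) : 2%:R != 0 :> K -> w != 0 ->
  (chebyshev K m).[(w + w^-1) / 2%:R] = (w ^+ m + w ^- m) / 2%:R.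
Proof.
move=> K2 w0.
have [] : (chebyshev K m).[(w + w^-1) / 2%:R] = (w ^+ m + w ^- m) / 2%:R /\
  (chebyshev K m.+1).[(w + w^-1) / 2%:R] = (w ^+ m.+1 + w ^- m.+1) / 2%:R; last by [].
elim: m => [|m [ih1 ih2]].
  rewrite /chebyshev /= hornerX hornerC !expr0 !expr1 invr1; split=> //.
  by field.
split=> //; rewrite chebyshevSS hornerD hornerN hornerZ hornerM hornerX ih1 ih2.
rewrite !exprS; have wm : w ^+ m != 0 by rewrite expf_neq0.
by field; rewrite wm w0 K2.
Qed.

Variable R : realType.

Let C2 : 2%:R != 0 :> R[i].
Proof. by rewrite pnatr_eq0. Qed.

Let C2R : 2%:R = (2%:R : R)%:C%C :> R[i].
Proof. by rewrite -[LHS](rmorph_nat (real_complex R)). Qed.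

Let cabs2 : cabs (2%:R : R[i]) = 2.
Proof. by rewrite C2R cabs_real ger0_norm. Qed.

Lemma chebyshev_le1 m (x : R) : `|x| <= 1 -> cabs (chebyshev R[i] m).[x%:C%C] <= 1.
Proof.
move=> x1; have x2 : x ^+ 2 <= 1 by rewrite -real_normK ?num_real// expr_le1.
have s2 : Num.sqrt (1 - x ^+ 2) ^+ 2 = 1 - x ^+ 2 by rewrite sqr_sqrtr// subr_ge0.
pose w : R[i] := (x +i* Num.sqrt (1 - x ^+ 2))%C.
pose v : R[i] := (x -i* Num.sqrt (1 - x ^+ 2))%C.
have wv : w * v = 1.
  apply/eqP; rewrite eq_complex /=; apply/andP; split; apply/eqP; last by ring.
  by rewrite mulrN opprK -!expr2 s2; ring.
have w0 : w != 0 by apply: contraTneq (oner_neq0 R[i]) => w0; rewrite -wv w0 mul0r eqxx.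
have wV : w^-1 = v by rewrite -[v]mul1r -(mulVf w0) -mulrA wv mulr1.
have cw : cabs w = 1 by rewrite /cabs /= s2 addrC subrK sqrtr1.
have -> : x%:C%C = (w + w^-1) / 2%:R.
  apply: (canRL (mulfK C2)); rewrite wV.
  apply/eqP; rewrite eq_complex /=; apply/andP; split; apply/eqP; ring.
rewrite chebyshev_joukowski// cabsM cabsV.
rewrite cabs2.
rewrite ler_pdivrMr// mul1r; apply: le_trans (cabsD _ _) _.
by rewrite cabsV !cabsX cw !expr1n invr1; lra.
Qed.

(** The base 3 suits the recurrence: [6 t^2 + 1 <= 9 t^2] for [t >= 1]. *)
Lemma chebyshev_growth m (x : R) : 1 <= `|x| ->
  cabs (chebyshev R[i] m).[x%:C%C] <= (3 * `|x|) ^+ m.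
Proof.
move=> x1.
have [] : cabs (chebyshev R[i] m).[x%:C%C] <= (3 * `|x|) ^+ m /\
  cabs (chebyshev R[i] m.+1).[x%:C%C] <= (3 * `|x|) ^+ m.+1; last by [].
elim: m => [|m [ih1 ih2]].
  by rewrite /chebyshev /= hornerX hornerC cabs1 cabs_real expr0 expr1; split=> //; lra.
split=> //; rewrite chebyshevSS hornerD hornerN hornerZ hornerM hornerX.
apply: le_trans (cabsD _ _) _; rewrite cabsN !cabsM cabs_real.
rewrite cabs2.
have h : 2 * (`|x| * cabs (chebyshev R[i] m.+1).[x%:C%C]) <= 2 * (`|x| * (3 * `|x|) ^+ m.+1).
  by rewrite ler_pM2l// ler_wpM2l.
apply: le_trans (lerD h ih1) _.
have x2 : 1 <= `|x| ^+ 2 by rewrite exprn_ege1.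
have : 0 <= (3 * `|x|) ^+ m * (3 * `|x| ^+ 2 - 1).
  by apply: mulr_ge0; [rewrite exprn_ge0// mulr_ge0|lra].
rewrite !exprS; set y := (3 * `|x|) ^+ m; set t := `|x|; rewrite expr0; lra.
Qed.

(** Here [w = i L] with [L = y + sqrt (1 + y^2) >= 1 + y]. The even degree gives [w^m] and [w^-m]
    the same sign, so nothing cancels. *)
Lemma chebyshev_at_i l (y : R) : 0 <= y ->
  (1 + y) ^+ l.*2 / 2 <= cabs (chebyshev R[i] l.*2).['i%C * y%:C%C].
Proof.
move=> y0; pose s := Num.sqrt (1 + y ^+ 2).
have s2 : s ^+ 2 = 1 + y ^+ 2 by rewrite sqr_sqrtr// addr_ge0 ?sqr_ge0.
have s1 : 1 <= s.
  by rewrite -[1]sqrtr1 ler_sqrt ?addr_ge0 ?sqr_ge0// lerDl sqr_ge0.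
pose L := y + s; have L0 : 0 < L by rewrite /L; lra.
pose w : R[i] := 'i%C * L%:C%C.
have w0 : w != 0.
  rewrite mulf_neq0// eq_complex /= ?oner_eq0 ?andbF//.
  by rewrite eqxx andbT gt_eqF.
have LV : L^-1 = s - y.
  apply: (mulfI (lt0r_neq0 L0)); rewrite divff ?lt0r_neq0//.
  by transitivity (s ^+ 2 - y ^+ 2); [rewrite s2|rewrite /L]; ring.
have -> : 'i%C * y%:C%C = (w + w^-1) / 2%:R.
  apply: (canRL (mulfK C2)); apply: (mulfI w0).
  rewrite [RHS](_ : _ = w * w + 1); last by rewrite mulrDr divff.
  have e1 : w * w = - (L ^+ 2)%:C%C.
    by apply/eqP; rewrite eq_complex /=; apply/andP; split; apply/eqP; ring.
  have e2 : w * ('i%C * y%:C%C * 2%:R) = - (2 * L * y)%:C%C.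
    rewrite C2R.
      by apply/eqP; rewrite eq_complex /=; apply/andP; split; apply/eqP; ring.
  have Ls : L * (s - y) = 1 by rewrite -LV divff ?lt0r_neq0.
  rewrite e1 e2; apply/eqP; rewrite eq_complex /=.
  apply/andP; split; apply/eqP; last by ring.
  by move: Ls s2; rewrite /L; lra.
rewrite chebyshev_joukowski// cabsM cabsV.
rewrite cabs2.
have e3 : w ^+ l.*2 = ((-1) ^+ l * L ^+ l.*2)%:C%C.
  rewrite -muln2 mulnC !exprM expr2.
  have -> : w * w = (- L ^+ 2)%:C%C.
    by apply/eqP; rewrite eq_complex /=; apply/andP; split; apply/eqP; ring.
  by rewrite -rmorphXn/= [in LHS]exprNn.
rewrite e3 -fmorphV -rmorphD cabs_real invfM invr_sign -mulrDr normrM normr_sign mul1r.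
have Lm : 0 < L ^+ l.*2 by rewrite exprn_gt0.
have Lm' : 0 < (L ^+ l.*2)^-1 by rewrite invr_gt0.
rewrite (ger0_norm (addr_ge0 (ltW Lm) (ltW Lm'))) ler_pM2r ?invr_gt0//.
apply: (@le_trans _ _ (L ^+ l.*2)); last by rewrite lerDl invr_ge0 ltW.
by apply: lerXn2r; rewrite ?nnegrE /L; lra.
Qed.

End Chebyshev.

(** * Dyadic decomposition of the integrals *)

Section DyadicIntegrals.
Variable R : realType.
Notation mu := (@lebesgue_measure R).

Lemma integral_itv_split (a b c : R) (f : R -> R) : a <= b -> b <= c ->
  measurable_fun `[a, c] f -> (forall x, a <= x <= c -> 0 <= f x) ->
  (\int[mu]_(x in `[a, c]) (f x)%:E =
   \int[mu]_(x in `[a, b]) (f x)%:E + \int[mu]_(x in `]b, c]) (f x)%:E)%E.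
Proof.
move=> ab bc mf f0.
have acE : `[a, c]%classic = (`[a, b] `|` `]b, c])%classic.
  by rewrite -itv_bndbnd_setU// bnd_simp.
rewrite acE ge0_integral_setU//.
- by apply/measurable_EFinP; rewrite -acE.
- by move=> x; rewrite -acE /= in_itv/= => /f0; rewrite lee_fin.
- apply/disj_set2P; rewrite -subset0 => x [] /=; rewrite !in_itv/=.
  by move=> /andP[_ xb] /andP[bx _]; have := lt_le_trans bx xb; rewrite ltxx.
Qed.

Lemma lebesgue_measure_itvoc (b c : R) : b <= c -> mu `]b, c]%classic = (c - b)%:E.
Proof.
rewrite le_eqVlt => /predU1P[->|bc].
  by rewrite set_itvoc0 measure0 subrr.
by rewrite lebesgue_measure_itv/= lte_fin bc EFinB.
Qed.

Lemma integral_itvoc_le (b c M : R) (f : R -> R) : b <= c ->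
  measurable_fun `]b, c] f -> (forall x, b < x <= c -> 0 <= f x <= M) ->
  (\int[mu]_(x in `]b, c]) (f x)%:E <= (M * (c - b))%:E)%E.
Proof.
move=> bc mf fM; rewrite EFinM -(lebesgue_measure_itvoc bc) -integral_cst//.
apply: ge0_le_integral => //.
- by move=> x /=; rewrite in_itv/= => /fM /andP[f0 _]; rewrite lee_fin.
- exact/measurable_EFinP.
- by move=> x /=; rewrite in_itv/= => /fM /andP[_ fx]; rewrite lee_fin.
Qed.

Lemma integral_itvoc_ge (b c M : R) (f : R -> R) : b <= c -> 0 <= M ->
  measurable_fun `]b, c] f -> (forall x, b < x <= c -> M <= f x) ->
  ((M * (c - b))%:E <= \int[mu]_(x in `]b, c]) (f x)%:E)%E.
Proof.
move=> bc M0 mf fM; rewrite EFinM -(lebesgue_measure_itvoc bc) -integral_cst//.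
apply: ge0_le_integral => //.
exact/measurable_EFinP.
Qed.

Section Weight.
Variable phi : R -> R.
Hypothesis phi_ge0 : forall x : R, 0 <= x -> 0 <= phi x.
Hypothesis phi_homo : {in `[0, +oo[ &, {homo phi : x y / x <= y}}.

Let phi_le (x y : R) : 0 <= x -> x <= y -> phi x <= phi y.
Proof.
by move=> x0 xy; apply: phi_homo; rewrite ?in_itv/= ?andbT//; exact: le_trans xy.
Qed.

Lemma measurable_phi_max : measurable_fun setT (fun x : R => phi (Num.max 0 x)).
Proof.
apply: nondecreasing_measurable => // x y xy; apply: phi_le.
  by rewrite le_max lexx.
by rewrite ge_max !le_max lexx xy orbT.
Qed.

Lemma measurable_phi_norm : measurable_fun setT (fun x : R => phi `|x|).
Proof.
have -> : (fun x : R => phi `|x|) = (fun x => phi (Num.max 0 x)) \o Num.norm.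
  by apply/funext => x /=; rewrite (max_idPr (normr_ge0 x)).
by apply: measurableT_comp measurable_phi_max _; exact: continuous_measurable_fun (@norm_continuous _ R).
Qed.

Let a (j : nat) : R := phi (2 ^+ j).

Let measurable_min n : measurable_fun (`[0, 1] : set R)
  (fun x : R => Num.min (phi x^-1) n%:R).
Proof.
apply/measurable_fun_itv_obnd_cbndP.
(* The inverse of 0 is 0, so the integrand is [min (phi 0) n] at 0 and monotonicity breaks there. On
   []0, 1]] it agrees with [f], which is nonincreasing on the whole line. *)
pose f (x : R) := if x <= 0 then n%:R else Num.min (phi x^-1) n%:R.
apply: (@eq_measurable_fun _ _ _ _ _ f).
  by move=> x; rewrite inE/= in_itv/= => /andP[x0 _]; rewrite /f leNgt x0.
apply: nonincreasing_measurable => // x y xy; rewrite /f.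
case: ifPn => [x0|]; first by rewrite (le_trans xy x0).
rewrite -ltNge => x0; case: ifPn => [_|]; first by rewrite ge_min lexx orbT.
rewrite -ltNge => y0; rewrite le_min !ge_min lexx orbT andbT phi_le ?invr_ge0 ?(ltW x0)//.
by rewrite lef_pV2 ?posrE.
Qed.

(** On []2^-(m+1), 2^-m]], of length [2^-(m+1)], the value [phi (1 / x)] lies between [a_m] and
    [a_(m+1)]. From above the index shift matches the length; from below it costs the factor 2. *)
Lemma Iphi_dyadic (n J : nat) : a J <= n%:R <= a J.+1 ->
  (\sum_(j < J.+1) a j / 2 ^+ j + n%:R / 2 ^+ J) / 2 <= Iphi phi n /\
  Iphi phi n <= \sum_(j < J.+1) a j / 2 ^+ j + n%:R / 2 ^+ J.
Proof.
case/andP=> aJ aJ1; pose f (x : R) := Num.min (phi x^-1) n%:R.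
pose e m := (\int[mu]_(x in `[0%R, (2 ^- m)%R]) (f x)%:E)%E.
have f0 x : 0 <= x -> 0 <= f x by move=> x0; rewrite le_min ler0n andbT phi_ge0 ?invr_ge0.
have fn x : f x <= n%:R by rewrite ge_min lexx orbT.
have p0 m : 0 < 2 ^- m :> R by rewrite invr_gt0 exprn_gt0.
have p1 m : 2 ^- m <= 1 :> R by rewrite invf_le1 ?exprn_gt0// exprn_ege1// ler1n.
have mf (S : set R) : S `<=` `[0, 1]%classic -> measurable_fun S f.
  by move=> SI; apply: measurable_funS (measurable_min n).
have pS m : 2 ^- m.+1 = 2 ^- m / 2 :> R by rewrite exprS invfM mulrC.
have half m : 2 ^- m - 2 ^- m.+1 = 2 ^- m.+1 :> R by rewrite pS; lra.
have step m : (e m = e m.+1 + \int[mu]_(x in `](2 ^- m.+1)%R, (2 ^- m)%R]) (f x)%:E)%E.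
  have pm := p0 m; apply: integral_itv_split; [exact: ltW|rewrite pS; lra| |].
    by apply: mf => x /=; rewrite !in_itv/= => /andP[-> xm]; exact: le_trans (p1 m).
  by move=> x /andP[/f0].
have mpiece m : measurable_fun (`]2 ^- m.+1, 2 ^- m] : set R) f.
  apply: mf => x /=; rewrite !in_itv/= => /andP[xm mx].
  by rewrite (le_trans (ltW (p0 m.+1)) (ltW xm)) (le_trans mx).
have upper m : (e 0%N <= (\sum_(j < m) a j.+1 / 2 ^+ j.+1)%:E + e m)%E.
  elim: m => [|m ih]; first by rewrite big_ord0 add0e.
  apply: le_trans ih _; rewrite big_ord_recr/= EFinD -addeA leeD2l// (step m) addeC.
  rewrite leeD2r//.
  have := @integral_itvoc_le (2 ^- m.+1) (2 ^- m) (a m.+1) f.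
  rewrite half; apply; [by have := p0 m; rewrite pS; lra|exact: mpiece|].
  move=> x /andP[mx xm]; have x0 := lt_trans (p0 _) mx.
  rewrite f0 ?(ltW x0)//= ge_min; apply/orP; left; apply: phi_le; first by rewrite invr_ge0 ltW.
  by rewrite -[leRHS]invrK lef_pV2 ?posrE// ltW.
(* Pieces are cut off only for indices up to [J], where [a_m <= n] keeps the minimum above [a_m]; on
   the remaining interval the minimum is [n], as [n <= a_(J+1)]. *)
have lower m : (m <= J.+1)%N -> ((\sum_(j < m) a j / 2 ^+ j.+1)%:E + e m <= e 0%N)%E.
  elim: m => [|m ih mJ]; first by rewrite big_ord0 add0e.
  apply: le_trans (ih (ltnW mJ)); rewrite big_ord_recr/= EFinD -addeA leeD2l// (step m) addeC.
  rewrite leeD2l//.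
  have := @integral_itvoc_ge (2 ^- m.+1) (2 ^- m) (a m) f.
  rewrite half; apply; [by have := p0 m; rewrite pS; lra|by rewrite phi_ge0// exprn_ge0|exact: mpiece|].
  move=> x /andP[mx xm]; have x0 := lt_trans (p0 _) mx.
  rewrite le_min; apply/andP; split.
    apply: phi_le; first by rewrite exprn_ge0.
    by rewrite -[leLHS]invrK lef_pV2 ?posrE.
  by apply: le_trans aJ; apply: phi_le; rewrite ?exprn_ge0// ler_weXn2l// ler1n.
have split0 m : (e m = \int[mu]_(x in `[0%R, 0%R]) (f x)%:E + \int[mu]_(x in `]0%R, (2 ^- m)%R]) (f x)%:E)%E.
  apply: integral_itv_split; [by []|exact: ltW| |].
    by apply: mf => x /=; rewrite !in_itv/= => /andP[-> xm]; exact: le_trans (p1 m).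
  by move=> x /andP[/f0].
have moc m : measurable_fun (`]0, 2 ^- m] : set R) f.
  apply: mf => x /=; rewrite !in_itv/= => /andP[xm mx].
  by rewrite (ltW xm) (le_trans mx).
have eJ : (e J <= (n%:R / 2 ^+ J)%:E)%E.
  rewrite split0 set_itv1 integral_set1 add0e.
  have := @integral_itvoc_le 0 (2 ^- J) n%:R f (ltW (p0 J)) (moc J).
  by rewrite subr0; apply => x /andP[x0 _]; rewrite fn f0 ?ltW.
have eJ1 : ((n%:R / 2 ^+ J.+1)%:E <= e J.+1)%E.
  rewrite split0 set_itv1 integral_set1 add0e.
  have := @integral_itvoc_ge 0 (2 ^- J.+1) n%:R f (ltW (p0 _)) (ler0n _ _) (moc J.+1).
  rewrite subr0; apply => x /andP[x0 xJ]; rewrite le_min lexx andbT.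
  apply: le_trans aJ1 _; apply: phi_le; first by rewrite exprn_ge0.
  by rewrite -[leLHS]invrK lef_pV2 ?posrE// ltW.
have up := le_trans (upper J) (leeD2l _ eJ).
have lo := le_trans (leeD2l _ eJ1) (lower J.+1 (leqnn _)).
have e0 : (0 <= e 0%N)%E.
  by apply: integral_ge0 => x /=; rewrite in_itv/= lee_fin => /andP[/f0].
have IE : Iphi phi n = fine (e 0%N) by rewrite /Iphi /e /Rintegral expr0 invr1.
have efin : e 0%N \is a fin_num.
  by rewrite ge0_fin_numE// (le_lt_trans up)// -EFinD ltry.
move: up lo; rewrite -(fineK efin) -!EFinD !lee_fin -IE => up lo; split.
  apply: le_trans lo; rewrite le_eqVlt; apply/orP; left; apply/eqP.
  rewrite mulrDl exprS invfM mulrA [n%:R / 2 / _]mulrAC; congr (_ + _).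
  rewrite mulr_suml; apply: eq_bigr => j _.
  by rewrite exprS invfM mulrCA mulrC.
apply: le_trans up _; rewrite lerD2r big_ord_recl/=
  [leRHS](_ : _ = a 0%N / 2 ^+ 0 + \sum_(j < J) a j.+1 / 2 ^+ j.+1)//.
by rewrite lerDr expr0 divr1 phi_ge0.
Qed.

(** On []2^m, 2^(m+1)]] the integrand is at most [a_(m+1) / 4^m], contributing at most twice
    [a_(m+1) / 2^(m+1)]. Bounded partial sums would therefore bound the integral, by monotone
    convergence. *)
Lemma dyadic_sum_diverges :
  (\int[mu]_(t in `[0%R, +oo[%classic) (phi t / (1 + t ^+ 2))%:E = +oo)%E ->
  forall B : R, exists J0, forall J, (J0 <= J)%N -> B <= \sum_(j < J.+1) a j / 2 ^+ j.
Proof.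
move=> Ioo B.
have a0 j : 0 <= a j by rewrite phi_ge0// exprn_ge0.
have b0 j : 0 <= a j / 2 ^+ j by rewrite divr_ge0 ?exprn_ge0.
have mono m k : (m <= k)%N -> \sum_(j < m) a j / 2 ^+ j <= \sum_(j < k) a j / 2 ^+ j.
  move=> mk; rewrite (big_ord_widen k (fun j => a j / 2 ^+ j) mk)
    [leRHS](bigID (fun j : 'I_k => (j < m)%N))/=.
  by rewrite lerDl sumr_ge0.
have [[J0 BJ]|nex] := pselect (exists J0, B <= \sum_(j < J0.+1) a j / 2 ^+ j).
  by exists J0 => J JJ; apply: le_trans BJ _; exact: mono.
exfalso.
have bnd m : \sum_(j < m) a j / 2 ^+ j <= B.
  apply: le_trans (mono m m.+1 _) _; first by [].
  by rewrite leNgt; apply/negP => lt; apply: nex; exists m; exact: ltW.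
pose g (t : R) := phi t / (1 + t ^+ 2).
have t2 (t : R) : 0 < 1 + t ^+ 2 by rewrite ltr_pwDl ?sqr_ge0.
have t21 (t : R) : 1 <= 1 + t ^+ 2 by rewrite lerDl sqr_ge0.
have g0 (t : R) : 0 <= t -> 0 <= g t.
  by move=> t0; apply: divr_ge0; [exact: phi_ge0|exact: ltW].
have mg (S : set R) : measurable S -> S `<=` `[0, +oo[%classic -> measurable_fun S g.
  move=> mS S0; pose g' (t : R) := phi (Num.max 0 t) * (1 + t ^+ 2)^-1.
  apply: (@eq_measurable_fun _ _ _ _ _ g').
    move=> t; rewrite inE => /S0; rewrite /= in_itv/= andbT => t0.
    by rewrite /g /g' (max_idPr t0).
  apply: measurable_funM; first by apply: measurable_funS measurable_phi_max.
  apply: measurable_funTS; apply: continuous_measurable_fun => t.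
  apply: cvgV; first by rewrite gt_eqF.
  by apply: cvgD; [exact: cvg_cst|exact: exprn_continuous].
have step m : (\int[mu]_(t in `[0%R, (2 ^+ m)%R]) (g t)%:E <=
    (a 0%N + 2 * \sum_(j < m) a j.+1 / 2 ^+ j.+1)%:E)%E.
  elim: m => [|m ih].
    rewrite big_ord0 mulr0 addr0 expr0.
    rewrite (@integral_itv_split 0 0 1)//; last by move=> x /andP[/g0].
      rewrite set_itv1 integral_set1 add0e -[a 0%N]mulr1 -[X in _ * X]subr0.
      apply: integral_itvoc_le => //; first by apply: mg => // x /=; rewrite !in_itv/= => /andP[/ltW ->].
      move=> x /andP[x0 x1]; rewrite g0 ?(ltW x0)//= /g ler_pdivrMr//.
      have h : phi x <= a 0%N by apply: phi_le; [exact: ltW|rewrite expr0].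
      by apply: le_trans h _; rewrite ler_peMr.
    by apply: mg => // x /=; rewrite !in_itv/= => /andP[->].
  have q0 : 0 < 2 ^+ m :> R by rewrite exprn_gt0.
  rewrite (@integral_itv_split 0 (2 ^+ m) (2 ^+ m.+1)); last 4 first.
  - exact: ltW.
  - by rewrite exprS; lra.
  - by apply: mg => // x /=; rewrite !in_itv/= => /andP[->].
  - by move=> x /andP[/g0].
  rewrite big_ord_recr/= [X in X%:E](_ : _ = a 0%N + 2 * (\sum_(j < m) a j.+1 / 2 ^+ j.+1)
    + 2 * (a m.+1 / 2 ^+ m.+1)); last by ring.
  rewrite [leRHS]EFinD; apply: (leeD ih).
  have -> : 2 * (a m.+1 / 2 ^+ m.+1) = a m.+1 / (2 ^+ m * 2 ^+ m) * (2 ^+ m.+1 - 2 ^+ m).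
    by rewrite exprS; field; rewrite gt_eqF.
  apply: integral_itvoc_le.
  - by rewrite exprS; lra.
  - by apply: mg => // x /=; rewrite !in_itv/= => /andP[/ltW mx _]; rewrite andbT (le_trans _ mx)// ltW.
  - move=> x /andP[mx xm]; have x0 := lt_trans q0 mx; rewrite g0 ?(ltW x0)//=.
    have x2 : 2 ^+ m * 2 ^+ m <= 1 + x ^+ 2 by nra.
    apply: ler_pM; [exact/phi_ge0/ltW|by rewrite invr_ge0 ltW|exact/phi_le/xm/ltW|].
    by rewrite lef_pV2 ?posrE ?mulr_gt0.
have U : \bigcup_m `[(0:R), 2 ^+ m]%classic = `[0, +oo[%classic.
  apply/seteqP; split => x /=.
    by move=> [m _]; rewrite /= !in_itv/= => /andP[->].
  rewrite in_itv/= andbT => x0; exists (Num.trunc x) => //=.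
  rewrite in_itv/= x0/=; apply: (@le_trans _ _ (Num.trunc x).+1%:R).
    by rewrite ltW// truncnS_gt.
  by rewrite -natrX ler_nat ltn_expl.
have : (\int[mu]_(t in `[0%R, +oo[%classic) (g t)%:E <= (a 0%N + 2 * B)%:E)%E.
  have cvI : (\int[mu]_(x in `[0%R, (2 ^+ i)%R]) (g x)%:E)%E @[i --> \oo] -->
      (\int[mu]_(t in `[0%R, +oo[%classic) (g t)%:E)%E.
    rewrite -U; apply: ge0_nondecreasing_set_cvg_integral => [m k mk|m|m|m x /=].
    - apply/subsetPset => x /=; rewrite !in_itv/= => /andP[-> xm]; apply: le_trans xm _.
      by rewrite ler_weXn2l// ler1n.
    - exact: measurable_itv.
    - by apply/measurable_EFinP; apply: mg => // x /=; rewrite !in_itv/= => /andP[->].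
    - by rewrite in_itv/= lee_fin => /andP[/g0].
  apply: (cvge_le _ cvI); apply: nearW => m; apply: le_trans (step m) _; rewrite lee_fin lerD2l ler_pM2l//.
  apply: le_trans (bnd m.+1); rewrite big_ord_recl/= lerDr//.
by rewrite Ioo.
Qed.

End Weight.
End DyadicIntegrals.

(** * Weighted norms *)

Section WeightedNorm.
Variable R : realType.
Notation mu := (@lebesgue_measure R).
Implicit Types (W h : R -> R) (p : \bar R).

Lemma integral_oneDsqr : (\int[mu]_x (1 + x ^+ 2)^-1%:E = pi%:E)%E.
Proof.
have x2 (x : R) : 1 + x ^+ 2 != 0 by rewrite gt_eqF// ltr_pwDl ?sqr_ge0.
rewrite ge0_symfun_integralT; last 3 first.
- by move=> x; rewrite invr_ge0 addr_ge0 ?sqr_ge0.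
- exact: continuous_oneDsqrV.
- by move=> x /=; rewrite sqrrN.
rewrite -set_itvcy integral0y_oneDsqr -EFinM.
by congr (_%:E); lra.
Qed.

Lemma powR_ge_sub1 (t r : R) : 0 <= t -> 1 <= r -> t <= 1 + t `^ r.
Proof.
move=> t0 r1; have [t1|t1] := leP t 1.
  by apply: le_trans t1 _; rewrite lerDl powR_ge0.
apply: (@le_trans _ _ (t `^ r)); last by rewrite lerDr.
by rewrite -[leLHS]powRr1// ler_powR// ltW.
Qed.

(** For a finite exponent [r], take [k = (h / (e W))^r] and use [t <= 1 + t^r]; for the supremum
    norm take [k = 0]. This removes [p] from the rest of the lower bound. *)
Lemma wnorm_le_pointwise p W h (e : R) : (1 <= p)%E -> 0 < e ->
  measurable_fun setT (fun x => h x / W x) -> (forall x, 0 <= h x / W x) ->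
  (wnorm p W h <= e%:E)%E ->
  exists k : R -> R, [/\ measurable_fun setT k, forall x, 0 <= k x,
    (\int[mu]_x (k x)%:E <= 1)%E & forall x, h x / W x <= e * (1 + k x)].
Proof.
case: p => [r| |//]; last first.
  move=> _ e0 mg g0 ge; exists (cst 0); split=> //.
    by rewrite integral0_eq.
  move=> x; rewrite addr0 mulr1 -lee_fin; apply: le_trans ge.
  by apply: ereal_sup_ubound; exists x.
rewrite lee_fin => r1 e0 mg g0 ge.
have r0 : 0 < r by exact: lt_le_trans r1.
pose g x := h x / W x.
exists (fun x => e `^ (- r) * (g x `^ r)); split.
- apply: measurable_funM => //.
  exact: measurableT_comp (measurable_powR r) mg.
- by move=> x; rewrite mulr_ge0 ?powR_ge0.
- under eq_integral do rewrite EFinM.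
  rewrite ge0_integralZl_EFin ?powR_ge0//; last 2 first.
  + by move=> x _; rewrite lee_fin powR_ge0.
  + by apply/measurable_EFinP; exact: measurableT_comp (measurable_powR r) mg.
  move: ge; rewrite /wnorm -/(g _).
  under eq_integral do rewrite -/(g _).
  set I := (\int[mu]_x _)%E => ge.
  have I0 : (0 <= I)%E by apply: integral_ge0 => x _; rewrite lee_fin powR_ge0.
  have Ie : (I <= (e `^ r)%:E)%E.
    have -> : I = ((I `^ r^-1) `^ r)%E by rewrite -poweRrM mulVf ?gt_eqF// poweRe1.
    rewrite -poweR_EFin; apply: gt0_ler_poweR ge; rewrite ?in_itv/= ?(ltW r0)//.
      by rewrite poweR_ge0 leey.
    by rewrite lee_fin (ltW e0) ?leey.
  apply: (@le_trans _ _ ((e `^ (- r))%:E * (e `^ r)%:E)%E).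
    by rewrite lee_wpmul2l// lee_fin powR_ge0.
  by rewrite -EFinM powRN mulVf// gt_eqF// powR_gt0.
- move=> x; have ge0 : 0 <= g x / e by rewrite divr_ge0 ?g0// ltW.
  rewrite -ler_pdivrMl// mulrC -/(g x); apply: le_trans (powR_ge_sub1 ge0 r1) _.
  rewrite lerD2l powRM ?g0 ?invr_ge0 ?(ltW e0)// mulrC.
  by rewrite -powR_inv1 ?(ltW e0)// -powRrM mulN1r.
Qed.

(** For finite [r] the integral is at most [M^r pi], because [(1 + x^2)^-1 <= 1] and [r >= 1]; its
    [r]-th root is at most [pi * M] as [pi >= 1]. *)
Lemma wnorm_le_of_decay p W h (M : R) : (1 <= p)%E -> 0 < M ->
  measurable_fun setT (fun x => h x / W x) ->
  (forall x, 0 <= h x / W x <= M / (1 + x ^+ 2)) ->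
  (wnorm p W h <= (pi * M)%:E)%E.
Proof.
have pi1 : 1 <= pi :> R by have := @pi_ge2 R; lra.
have x1 (x : R) : 1 <= 1 + x ^+ 2 by rewrite lerDl sqr_ge0.
have x0 (x : R) : 0 < 1 + x ^+ 2 by rewrite ltr_pwDl ?sqr_ge0.
case: p => [r| |//]; last first.
  move=> _ M0 _ gM; apply: ge_ereal_sup => _ [x _ <-]; rewrite lee_fin.
  have /andP[_ gx] := gM x; apply: le_trans gx _; rewrite ler_pdivrMr//.
  have := x1 x; have : M <= pi * M by rewrite ler_peMl// ltW.
  by move=> h1 h2; apply: le_trans h1 _; apply: ler_peMr => //; apply: mulr_ge0; [exact: pi_ge0|exact: ltW].
rewrite lee_fin => r1 M0 mg gM; have r0 : 0 < r by exact: lt_le_trans r1.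
pose g x := h x / W x.
have mI : measurable_fun setT (fun x : R => ((1 + x ^+ 2)^-1)).
  by apply: continuous_measurable_fun; exact: (@continuous_oneDsqrV R).
have Ile : (\int[mu]_x (g x `^ r)%:E <= (M `^ r * pi)%:E)%E.
  apply: (@le_trans _ _ (\int[mu]_x ((M `^ r)%:E * (1 + x ^+ 2)^-1%:E))%E); last first.
    rewrite ge0_integralZl_EFin ?powR_ge0//; last 2 first.
    - by move=> x _; rewrite lee_fin invr_ge0 ltW.
    - exact/measurable_EFinP.
    by rewrite integral_oneDsqr -EFinM.
  apply: ge0_le_integral => //.
  - by move=> x _; rewrite lee_fin powR_ge0.
  - by apply/measurable_EFinP; exact: measurableT_comp (measurable_powR r) mg.
  - by apply: emeasurable_funM => //; exact/measurable_EFinP.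
  - move=> x _; rewrite -EFinM lee_fin; have /andP[g0 gx] := gM x.
    have i0 : 0 < (1 + x ^+ 2)^-1 by rewrite invr_gt0.
    apply: (@le_trans _ _ ((M / (1 + x ^+ 2)) `^ r)).
      by apply: ge0_ler_powR => //; rewrite ?(ltW r0)// nnegrE divr_ge0 ?ltW.
    rewrite powRM ?(ltW M0) ?(ltW i0)// ler_wpM2l ?powR_ge0//.
    rewrite -[leRHS]powRr1 ?(ltW i0)//; apply: ger_powR => //.
    by rewrite i0 invf_le1// x1.
have -> : wnorm r%:E W h = ((\int[mu]_x (g x `^ r)%:E) `^ r^-1)%E by [].
have I0 : (0 <= \int[mu]_x (g x `^ r)%:E)%E.
  by apply: integral_ge0 => x _; rewrite lee_fin powR_ge0.
apply: (@le_trans _ _ ((M `^ r * pi)%:E `^ r^-1)%E).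
  apply: gt0_ler_poweR; rewrite ?invr_ge0 ?(ltW r0)// in_itv/= ?I0 ?leey//.
  by rewrite lee_fin mulr_ge0 ?powR_ge0 ?pi_ge0 ?leey.
rewrite poweR_EFin lee_fin powRM ?powR_ge0 ?pi_ge0// -powRrM mulfV ?gt_eqF//.
rewrite powRr1 ?(ltW M0)// mulrC ler_wpM2r ?(ltW M0)//.
by apply: ler1_powR => //; rewrite invf_le1.
Qed.

(** Markov's inequality; the numerator 2 instead of 1 yields the contradiction [2 <= 1] from
    non-strict bounds. *)
Lemma exists_small_value (k : R -> R) (b c : R) : b < c -> measurable_fun setT k ->
  (forall x, 0 <= k x) -> (\int[mu]_x (k x)%:E <= 1)%E ->
  exists2 x, b <= x <= c & k x <= 2 / (c - b).
Proof.
move=> bc mk k0 Ik.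
have [[x xbc kx]|nex] := pselect (exists2 x, b <= x <= c & k x <= 2 / (c - b)).
  by exists x.
have cb : 0 < c - b by rewrite subr_gt0.
have : ((2 / (c - b) * (c - b))%:E <= \int[mu]_(x in `]b, c]) (k x)%:E)%E.
  apply: integral_itvoc_ge; [exact: ltW|by rewrite divr_ge0// ltW|exact: measurable_funTS|].
  move=> x /andP[bx xc]; rewrite leNgt; apply/negP => kx; apply: nex.
  by exists x; [rewrite (ltW bx) xc|exact: ltW].
rewrite divfK ?gt_eqF// => I2.
exfalso; have : ((2 : R)%:E <= (1 : R)%:E)%E.
  apply: le_trans I2 _; apply: le_trans Ik; apply: ge0_subset_integral => //.
    exact/measurable_EFinP.
  by move=> x _; rewrite lee_fin.
by rewrite lee_fin; lra.
Qed.

(** The constant 5 bounds [pi + 1], the integral of [1 / (1 + x^2)] plus that of [k]. *)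
Lemma integral_poisson_le (k G : R -> R) (C A : R) : 0 <= C -> measurable_fun setT k ->
  (forall x, 0 <= k x) -> (\int[mu]_x (k x)%:E <= 1)%E ->
  measurable_fun setT G -> (forall x, 0 <= G x <= C * (1 + k x)) ->
  (\int[mu]_(x in `[(- A)%R, A]) (G x / (1 + x ^+ 2))%:E <= (5 * C)%:E)%E.
Proof.
move=> C0 mk k0 Ik mG GC.
have x1 (x : R) : 1 <= 1 + x ^+ 2 by rewrite lerDl sqr_ge0.
have x0 (x : R) : 0 < 1 + x ^+ 2 by rewrite ltr_pwDl ?sqr_ge0.
have mI : measurable_fun setT (fun x : R => ((1 + x ^+ 2)^-1)).
  by apply: continuous_measurable_fun; exact: (@continuous_oneDsqrV R).
have mGI : measurable_fun setT (fun x : R => G x / (1 + x ^+ 2)) by exact: measurable_funM.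
have G0 (x : R) : 0 <= G x / (1 + x ^+ 2).
  by have /andP[? _] := GC x; rewrite divr_ge0 ?(ltW (x0 x)).
apply: (@le_trans _ _ (\int[mu]_x (G x / (1 + x ^+ 2))%:E)%E).
  apply: ge0_subset_integral => //; first exact/measurable_EFinP.
  by move=> x _; rewrite lee_fin.
apply: (@le_trans _ _ (\int[mu]_x (C%:E * ((1 + x ^+ 2)^-1%:E + (k x)%:E)))%E).
  apply: ge0_le_integral => //.
  - by move=> x _; rewrite lee_fin.
  - exact/measurable_EFinP.
  - apply: emeasurable_funM => //; apply: emeasurable_funD; exact/measurable_EFinP.
  - move=> x _; rewrite -EFinD -EFinM lee_fin; have /andP[_ h] := GC x.
    rewrite ler_pdivrMr//; apply: le_trans h _; rewrite -mulrA ler_wpM2l//.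
    rewrite mulrDl mulVf ?gt_eqF// lerD2l ler_peMr//.
rewrite ge0_integralZl_EFin//; last 2 first.
- by move=> x _; rewrite -EFinD lee_fin addr_ge0// invr_ge0 ltW.
- by apply: emeasurable_funD; exact/measurable_EFinP.
rewrite ge0_integralD//; last 4 first.
- by move=> x _; rewrite lee_fin invr_ge0 ltW.
- exact/measurable_EFinP.
- by move=> x _; rewrite lee_fin.
- exact/measurable_EFinP.
rewrite integral_oneDsqr [5 * C]mulrC EFinM; apply: lee_wpmul2l; first by rewrite lee_fin.
apply: (@le_trans _ _ (pi%:E + 1%:E)%E); first by rewrite leeD2l.
by rewrite -EFinD lee_fin; have := @pihalf_lt2 R; lra.
Qed.

Definition cauchy_error (Q : {poly R[i]}) (x : R) : R :=
  cabs ((x%:C - 'i)^-1 - Q.[x%:C])%C.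

Lemma cauchy_errorE (P : {poly R[i]}) (x : R) : cauchy_error P x =
  cabs (1 - ('X - 'i%C%:P) * P).[x%:C%C] / Num.sqrt (1 + x ^+ 2).
Proof.
rewrite /cauchy_error -cabs_sub_i; apply: (canRL (mulfK _)).
  by apply: contra_neq (sub_i_neq0 x); exact: cabs_eq0.
rewrite -cabsM; congr cabs.
rewrite mulrBl mulVf ?sub_i_neq0// hornerD hornerN hornerM hornerXsubC hornerC.
by rewrite [_ * P.[_]]mulrC.
Qed.

End WeightedNorm.

(** * Lower bound *)

Section LowerBound.
Variable R : realType.
Notation mu := (@lebesgue_measure R).

Lemma expR1_ge2 : 2 <= expR 1 :> R.
Proof. by apply: le_trans (expR_ge1Dx 1); lra. Qed.

(** A pole at [-i b] contributes at least [e^(1/4)] as soon as [|x| >= b]. The exponent is what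
    [e <= 4] allows: [e^(1/2) <= 2 <= 1 + y^2]. *)
Lemma expR_quarter_le (y : R) : 1 <= y -> expR 4^-1 <= Num.sqrt (1 + y ^+ 2).
Proof.
move=> y1; have e4 : expR 4^-1 ^+ 4 <= 4 :> R.
  by rewrite -expRM_natl divff// expR1_le4.
have e0 : 0 < expR 4^-1 :> R by exact: expR_gt0.
have e2 : expR 4^-1 ^+ 2 <= 2 :> R.
  rewrite -(@ler_pXn2r _ 2%N)// ?nnegrE ?exprn_ge0 ?(ltW e0)// -exprM.
  by apply: le_trans e4 _; rewrite expr2; lra.
rewrite -[leLHS]ger0_norm ?(ltW e0)// -sqrtr_sqr ler_sqrt ?addr_ge0 ?sqr_ge0//.
have y2 : 1 <= y ^+ 2 by rewrite exprn_ege1.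
by lra.
Qed.

Lemma expR_quarterX_le (y : R) (c : nat) : 1 <= y ->
  expR (c%:R / 4) <= Num.sqrt (1 + y ^+ 2) ^+ c.
Proof.
move=> y1; rewrite expRM_natl; apply: lerXn2r.
- by rewrite nnegrE expR_ge0.
- by rewrite nnegrE sqrtr_ge0.
- exact: expR_quarter_le.
Qed.

Lemma sqrt1D_ge1 (y : R) : 1 <= Num.sqrt (1 + y ^+ 2).
Proof. by rewrite -[leLHS]sqrtr1 ler_sqrt ?addr_ge0 ?sqr_ge0// lerDl sqr_ge0. Qed.

Lemma prod_ge1_ge (J : nat) (F : 'I_J -> R) (i : 'I_J) :
  (forall j, 1 <= F j) -> F i <= \prod_j F j.
Proof.
move=> F1; rewrite (bigD1 i)//= ler_peMr//; first exact: le_trans (F1 i).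
elim/big_ind: _ => // x y x1 y1; exact: mulr_ege1.
Qed.

Section Weight.
Variable phi : R -> R.
Hypothesis phi_ge0 : forall x : R, 0 <= x -> 0 <= phi x.
Hypothesis phi_homo : {in `[0, +oo[ &, {homo phi : x y / x <= y}}.

Let phi_le (x y : R) : 0 <= x -> x <= y -> phi x <= phi y.
Proof.
by move=> x0 xy; apply: phi_homo; rewrite ?in_itv/= ?andbT//; exact: le_trans xy.
Qed.

Let a (j : nat) : R := phi (2 ^+ j).
Let W (x : R) : R := expR (phi `|x|).

Lemma measurable_weighted_error (Q : {poly R[i]}) : measurable_fun setT
  (fun x : R => cauchy_error Q x / W x).
Proof.
apply: measurable_funM; last first.
  have -> : (fun x => (W x)^-1) = (fun x => expR (- x)) \o (fun x => phi `|x|).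
    by apply/funext => x; rewrite /W /= expRN.
  apply: measurableT_comp; last exact: measurable_phi_norm.
  apply: continuous_measurable_fun => x; apply: continuous_comp; last exact: continuous_expR.
  exact: opp_continuous.
have -> : cauchy_error Q = fun x =>
    cabs (1 - ('X - 'i%C%:P) * Q).[x%:C%C] / Num.sqrt (1 + x ^+ 2).
  by apply/funext => x; exact: cauchy_errorE.
apply: continuous_measurable_fun => x; apply: cvgM; first exact: continuous_cabs_horner.
apply: cvgV; first by rewrite gt_eqF// (lt_le_trans _ (sqrt1D_ge1 x)).
apply: (@continuous_comp R R R (fun x => 1 + x ^+ 2) (@Num.sqrt R)); last exact: sqrt_continuous.
by apply: cvgD; [exact: cvg_cst|exact: exprn_continuous].
Qed.

(** With factors at least [e^(1/4)], multiplicity [4 a_(j+1)] produces [e^(a_(j+1))], the maximum of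
    [W] for [2^j <= |x| <= 2^(j+1)]; adding 1 makes up for the truncation. *)
Let mult (j : nat) : nat := (Num.trunc (4 * a j.+1) + 1)%N.

Let a0 j : 0 <= a j. Proof. by rewrite phi_ge0// exprn_ge0. Qed.

Let mult_ge j : 4 * a j.+1 <= (mult j)%:R.
Proof. by rewrite /mult addn1 ltW// truncnS_gt. Qed.

Let mult_le j : (mult j)%:R <= 4 * a j.+1 + 1.
Proof. by rewrite /mult natrD lerD2r truncn_le mulr_ge0. Qed.

(** The two poles with [b = 1] contribute [1 + x^2], which absorbs the square-root factors left by
    the denominator [x - i]. *)
Let poles (n J : nat) : seq R := nseq 2 1
  ++ flatten [seq nseq (mult j) (2 ^+ j) | j <- index_iota 0 J] ++ nseq (33 * n) (2 ^+ J).

Let prod_poles (n J : nat) (f : R -> R) : \prod_(b <- poles n J) f b =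
  f 1 ^+ 2 * (\prod_(j < J) f (2 ^+ j) ^+ mult j * f (2 ^+ J) ^+ (33 * n)).
Proof.
rewrite !big_cat/= big_flatten/= big_map big_mkord.
rewrite big_nseq iter_mulr_1 !big_cons big_nil mulr1 -expr2; congr (_ * (_ * _)).
by apply: eq_bigr => j _ /=; rewrite big_nseq iter_mulr_1.
Qed.

Let poles_ge1 n J : all (fun b => 1 <= b) (poles n J).
Proof.
apply/allP => b; rewrite !mem_cat => /orP[|/orP[]].
- by rewrite mem_nseq => /andP[_ /eqP ->].
- case/flattenP => s /mapP[j _ ->]; rewrite mem_nseq => /andP[_ /eqP ->].
  by rewrite exprn_ege1// ler1n.
- by rewrite mem_nseq => /andP[_ /eqP ->]; rewrite exprn_ege1// ler1n.
Qed.

Let D n J := \sum_(j < J.+1) a j / 2 ^+ j + n%:R / 2 ^+ J.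

(** From [1 + y <= e^y]. Half of the 4 comes from the double pole, half from rounding the
    multiplicities; writing [a_(j+1) / 2^j] with denominator [2^(j+1)] turns 4 into 8, which is
    below 33. *)
Let poles_at_i n J : \prod_(b <- poles n J) (1 + b^-1) <= expR (4 + 33 * D n J).
Proof.
have le_exp (y : R) c : 0 <= y -> (1 + y) ^+ c <= expR (c%:R * y).
  by move=> y0; rewrite expRM_natl; apply: lerXn2r; rewrite ?nnegrE ?expR_ge0 ?addr_ge0 ?expR_ge1Dx.
have i0 j : 0 <= (2 ^+ j)^-1 :> R by rewrite invr_ge0 exprn_ge0.
have J0 : 0 < 2 ^+ J :> R by rewrite exprn_gt0.
rewrite prod_poles; apply: (@le_trans _ _ (expR (2%:R * 1^-1) *
   (expR (\sum_(j < J) (mult j)%:R * (2 ^+ j)^-1) * expR ((33 * n)%:R * (2 ^+ J)^-1)))).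
  have pr0 : 0 <= \prod_(j < J) (1 + (2 ^+ j)^-1 : R) ^+ mult j.
    by apply: prodr_ge0 => j _; rewrite exprn_ge0 ?addr_ge0.
  have q0 : 0 <= (1 + (2 ^+ J)^-1 : R) ^+ (33 * n) by rewrite exprn_ge0 ?addr_ge0.
  apply: ler_pM; [by rewrite exprn_ge0 ?addr_ge0 ?invr_ge0|exact: mulr_ge0| |].
    by apply: le_exp; rewrite invr_ge0.
  apply: ler_pM => //; last exact: le_exp.
  rewrite expR_sum; apply: ler_prod => j _.
  by rewrite exprn_ge0 ?addr_ge0//= le_exp.
rewrite -!expRD ler_expR invr1 mulr1 /D.
have geo : \sum_(j < J) (2 ^+ j)^-1 <= 2 :> R.
  under eq_bigr do rewrite -exprVn.
  by apply: sum_geo_le; [apply/andP; split|]; lra.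
have S : \sum_(j < J) (mult j)%:R * (2 ^+ j)^-1 <= 8 * (\sum_(j < J.+1) a j / 2 ^+ j) + 2.
  apply: (@le_trans _ _ (\sum_(j < J) (8 * (a j.+1 / 2 ^+ j.+1) + (2 ^+ j)^-1))).
    apply: ler_sum => j _; apply: le_trans (ler_wpM2r (i0 j) (mult_le j)) _.
    rewrite mulrDl mul1r lerD2r exprS invfM.
    by rewrite (_ : 8 * _ = 4 * a j.+1 * (2 ^+ j)^-1)//; field; rewrite expf_neq0.
  rewrite big_split/=; apply: lerD => //.
  by rewrite -mulr_sumr ler_pM2l// [leRHS]big_ord_recl lerDr expr0 divr1.
have S0 : 0 <= \sum_(j < J.+1) a j / 2 ^+ j.
  by apply: sumr_ge0 => j _; rewrite divr_ge0 ?exprn_ge0.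
rewrite natrM; lra.
Qed.

(** The factor 70 is 5 * 2 * 7: 5 from [integral_poisson_le], 2 from [poisson_quotient], 7 from the
    estimate of [P] outside [[-2^J, 2^J]]. *)
Lemma lower_bound p (n J : nat) (Q : {poly R[i]}) (e : R) : (1 <= p)%E -> 0 < e ->
  a J <= n%:R <= a J.+1 -> (size Q <= n)%N ->
  (wnorm p W (cauchy_error Q) <= e%:E)%E ->
  1 <= e * (70 * expR (a 0%N)) * expR (4 + 33 * D n J).
Proof.
move=> p1 e0 /andP[aJn naJ] sQ we.
have W0 x : 0 < W x by exact: expR_gt0.
have [k [mk k0 Ik gk]] := wnorm_le_pointwise p1 e0 (measurable_weighted_error Q)
  (fun x => divr_ge0 (cabs_ge0 _) (ltW (W0 x))) we.
pose P := 1 - ('X - 'i%C%:P) * Q.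
have sP : (size P <= n.+1)%N.
  apply: leq_trans (size_polyD _ _) _; rewrite size_poly1 size_polyN geq_max /=.
  by apply: leq_trans (size_polyMleq _ _) _; rewrite size_XsubC.
have Pi : P.['i%C] = 1 by rewrite /P hornerD hornerN hornerM hornerXsubC subrr mul0r subr0 hornerC.
have Pk x : cabs P.[x%:C%C] <= Num.sqrt (1 + x ^+ 2) * W x * (e * (1 + k x)).
  have s0 : 0 < Num.sqrt (1 + x ^+ 2) by rewrite (lt_le_trans _ (sqrt1D_ge1 x)).
  have := gk x; rewrite cauchy_errorE -/P ler_pdivrMr// ler_pdivrMr//.
  by move/le_trans; apply; rewrite le_eqVlt; apply/orP; left; apply/eqP; ring.
pose S (x : R) := \prod_(b <- poles n J) Num.sqrt (1 + (x / b) ^+ 2).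
have S1 (x : R) : 1 <= \prod_(j < J) Num.sqrt (1 + (x / 2 ^+ j) ^+ 2) ^+ mult j.
  elim/big_ind: _ => // [y z y1 z1|j _]; first exact: mulr_ege1.
  by rewrite exprn_ege1// sqrt1D_ge1.
have SE (x : R) : S x = (1 + x ^+ 2) *
    (\prod_(j < J) Num.sqrt (1 + (x / 2 ^+ j) ^+ 2) ^+ mult j *
     Num.sqrt (1 + (x / 2 ^+ J) ^+ 2) ^+ (33 * n)).
  rewrite /S (prod_poles n J (fun b => Num.sqrt (1 + (x / b) ^+ 2))) divr1 sqr_sqrtr//.
  by rewrite addr_ge0 ?sqr_ge0.
have sq_le (x : R) : Num.sqrt (1 + x ^+ 2) <= 1 + x ^+ 2.
  have s1 := sqrt1D_ge1 x; rewrite -[leRHS]sqr_sqrtr ?addr_ge0 ?sqr_ge0//.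
  by rewrite expr2 ler_peMr// (le_trans ler01).
have S0 x : 0 < S x.
  by apply: prodr_gt0 => b _; rewrite (lt_le_trans _ (sqrt1D_ge1 _)).
have ea1 : 1 <= expR (a 0%N) by rewrite -[leLHS]expR0 ler_expR.
have k1 x : 1 <= 1 + k x by rewrite lerDl.
pose T : R := 2 ^+ J.
have T1 : 1 <= T by rewrite exprn_ege1// ler1n.
have T0 : 0 < T by exact: lt_le_trans T1.
have n0 : 0 <= n%:R :> R by [].
have inside x : `|x| <= T -> W x <= expR (a 0%N) * (S x / Num.sqrt (1 + x ^+ 2)).
  move=> xT.
  have s0 : 0 < Num.sqrt (1 + x ^+ 2) by rewrite (lt_le_trans _ (sqrt1D_ge1 x)).
  have [x1|x1] := leP `|x| 1.
    apply: (@le_trans _ _ (expR (a 0%N))); first by rewrite ler_expR phi_le// /a expr0.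
    rewrite ler_peMr ?expR_ge0// ler_pdivlMr// mul1r SE.
    apply: le_trans (sq_le x) _; rewrite ler_peMr ?addr_ge0 ?sqr_ge0//.
    by apply: mulr_ege1 => //; rewrite exprn_ege1// sqrt1D_ge1.
  (* The single block of poles at the scale just below [|x|] already dominates [W]; all other
     factors are at least 1. *)
  have [i iJ xi] : exists2 i, (i < J)%N & 2 ^+ i < `|x| <= 2 ^+ i.+1.
    have : exists m, `|x| <= 2 ^+ m by exists J.
    case/ex_minnP => -[|i] xi imin; first by move: xi; rewrite expr0 leNgt x1.
    exists i; first exact: imin.
    by rewrite xi andbT ltNge; apply/negP => /imin; rewrite ltnn.
  have /andP[ix xi1] := xi.
  apply: (@le_trans _ _ (expR (a i.+1))); first by rewrite ler_expR phi_le.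
  apply: (@le_trans _ _ (S x / Num.sqrt (1 + x ^+ 2))); last first.
    by rewrite ler_peMl// divr_ge0 ?(ltW (S0 _)) ?ltW.
  rewrite ler_pdivlMr// mulrC SE; apply: ler_pM; rewrite ?expR_ge0 ?sq_le ?(ltW s0)//.
  apply: (@le_trans _ _ (\prod_(j < J) Num.sqrt (1 + (x / 2 ^+ j) ^+ 2) ^+ mult j)); last first.
    by rewrite ler_peMr ?(le_trans ler01)// exprn_ege1// sqrt1D_ge1.
  apply: le_trans (@prod_ge1_ge J _ (Ordinal iJ) _); last first.
    by move=> j; rewrite exprn_ege1// sqrt1D_ge1.
  rewrite /= -[x / _]/(x / 2 ^+ i) -(real_normK (num_real (x / 2 ^+ i))).
  apply: le_trans (expR_quarterX_le _ _); last first.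
    by rewrite normrM normfV (ger0_norm (exprn_ge0 _ _))// ler_pdivlMr ?exprn_gt0// mul1r ltW.
  by rewrite ler_expR ler_pdivlMr// [leLHS]mulrC; exact: mult_ge.
have outside x : T < `|x| -> cabs P.[x%:C%C] <= 7 * e * S x.
  move=> xT; pose s := T / (2 * n%:R + 1).
  have d0 : 0 < 2 * n%:R + 1 :> R by lra.
  have s0 : 0 < s by rewrite divr_gt0.
  have sT : (2 * n%:R + 1) * s = T by rewrite /s mulrC divfK ?gt_eqF.
  (* Nodes are picked where [k] is small, one in each of the separated intervals that
     [growth_outside] allows, all inside [[0, T]], where [W] is at most [e^n]. *)
  have node (m : nat) : exists2 y, 2 * m%:R * s <= y <= (2 * m%:R + 1) * s & k y <= 2 / s.
    have := @exists_small_value R k (2 * m%:R * s) ((2 * m%:R + 1) * s) _ mk k0 Ik.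
    rewrite (_ : (2 * m%:R + 1) * s - 2 * m%:R * s = s); last by ring.
    by apply; rewrite ltr_pM2r//; lra.
  have [y yP] : {y : nat -> R | forall m,
      2 * m%:R * s <= y m <= (2 * m%:R + 1) * s /\ k (y m) <= 2 / s}.
    have c m : {z | 2 * m%:R * s <= z <= (2 * m%:R + 1) * s /\ k z <= 2 / s}.
      by apply: cid; have [z z1 z2] := node m; exists z.
    by exists (fun m => sval (c m)) => m; exact: (svalP (c m)).
  pose M := Num.sqrt (1 + T ^+ 2) * expR n%:R * (e * (1 + 2 / s)).
  have hM m : (m <= n)%N -> cabs P.[(y m)%:C%C] <= M.
    move=> mn; have [/andP[y1 y2] y3] := yP m.
    have y0 : 0 <= y m by apply: le_trans y1; rewrite mulr_ge0 ?(ltW s0)// mulr_ge0.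
    have yT : y m <= T.
      by apply: le_trans y2 _; rewrite -sT ler_pM2r// lerD2r ler_pM2l// ler_nat.
    apply: le_trans (Pk _) _; apply: ler_pM.
    - by rewrite mulr_ge0 ?sqrtr_ge0 ?ltW.
    - by rewrite mulr_ge0 ?(ltW e0)// addr_ge0.
    - apply: ler_pM; rewrite ?sqrtr_ge0 ?(ltW (W0 _))//.
        by rewrite ler_sqrt ?addr_ge0 ?sqr_ge0// lerD2l lerXn2r ?nnegrE// ltW.
      rewrite ler_expR; apply: le_trans aJn; rewrite ger0_norm//; exact: phi_le.
    - by rewrite ler_pM2l// lerD2l.
  have := growth_outside sP s0 (fun m _ => (yP m).1) hM; rewrite sT => /(_ x (ltW xT)).
  move/le_trans; apply.
  pose u := `|x| / T; have u1 : 1 <= u by rewrite ler_pdivlMr// mul1r ltW.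
  have u0 : 0 <= u by exact: le_trans u1.
  rewrite -mulrA -/u SE.
  have h1 : Num.sqrt (1 + T ^+ 2) <= 1 + x ^+ 2.
    apply: le_trans (sq_le T) _; rewrite lerD2l -(real_normK (num_real x)).
    by rewrite lerXn2r ?nnegrE// ltW.
  (* Since [T >= 1], the left side is at most [3 + 4 n <= 7 (1 + n)]. *)
  have h2 : 1 + 2 / s <= 7 * expR n%:R.
    have : 1 + n%:R <= expR n%:R :> R by exact: expR_ge1Dx.
    have : 2 / s <= 2 * (2 * n%:R + 1).
      rewrite ler_pM2l// /s invf_div ler_pdivrMr// ler_peMr//; exact: ltW.
    lra.
  (* One [e^n] bounds [W] at the nodes, the other comes from [h2]. Of each 33 factors, one pays for
     [u] and 32 give [e^8 >= 48 e^2]. *)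
  have h3 : expR n%:R * expR n%:R * (48 * u) ^+ n <= Num.sqrt (1 + u ^+ 2) ^+ (33 * n).
    rewrite -[n%:R]mulr1 expRM_natl -!exprMn exprM; apply: lerXn2r.
    - by rewrite nnegrE; apply: mulr_ge0; apply: mulr_ge0 => //; exact: expR_ge0.
    - by rewrite nnegrE exprn_ge0// sqrtr_ge0.
    have q := expR_quarterX_le 32 u1.
    have su : u <= Num.sqrt (1 + u ^+ 2).
      rewrite -[leLHS]ger0_norm// -sqrtr_sqr ler_sqrt ?addr_ge0 ?sqr_ge0//.
      by rewrite lerDr.
    have e8 : expR 1 * expR 1 * 48 <= expR (32%:R / 4) :> R.
      rewrite (_ : 32%:R / 4 = 8%:R * 1); last by lra.
      rewrite expRM_natl; have := expR1_ge2; move: (expR 1) => E E2.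
      rewrite (_ : E ^+ 8 = E * E * E ^+ 6); last by ring.
      rewrite ler_pM2l ?mulr_gt0//; try lra.
      apply: (@le_trans _ _ (2 ^+ 6)); first by rewrite !exprS expr0; lra.
      by apply: lerXn2r; rewrite ?nnegrE; lra.
    rewrite (_ : _ * (48 * u) = u * (expR 1 * expR 1 * 48)); last by ring.
    rewrite [leRHS]exprS.
    apply: ler_pM => //; last exact: le_trans e8 q.
  have -> : Num.sqrt (1 + (x / 2 ^+ J) ^+ 2) = Num.sqrt (1 + u ^+ 2).
    rewrite -(real_normK (num_real (x / _))) normrM normfV.
    by rewrite [`|2 ^+ J|]ger0_norm// exprn_ge0.
  have s1 := S1 x; have q0 : 0 <= (48 * u) ^+ n by apply: exprn_ge0; exact: mulr_ge0.
  have en0 : 0 <= expR n%:R :> R by exact: expR_ge0.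
  apply: (@le_trans _ _ ((1 + x ^+ 2) * expR n%:R * (e * (7 * expR n%:R)) * (48 * u) ^+ n)).
    rewrite ler_wpM2r// /M; apply: ler_pM.
    - by rewrite mulr_ge0 ?sqrtr_ge0.
    - by rewrite mulr_ge0 ?(ltW e0)// addr_ge0// divr_ge0 ?ltW.
    - by rewrite ler_wpM2r.
    - by rewrite ler_pM2l.
  rewrite [leLHS](_ : _ = 7 * e * (1 + x ^+ 2) * (expR n%:R * expR n%:R * (48 * u) ^+ n)); last by ring.
  rewrite -[leRHS]mulrA [leRHS]mulrA [leRHS]mulrA ler_wpM2l//.
    by rewrite !mulr_ge0 ?(ltW e0)// addr_ge0 ?sqr_ge0.
  by apply: le_trans h3 _; rewrite ler_peMl// exprn_ge0 ?sqrtr_ge0.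
pose B := 7 * expR (a 0%N) * e.
have B0 : 0 < B by rewrite !mulr_gt0 ?expR_gt0.
have PS x : cabs P.[x%:C%C] / S x <= B * (1 + k x).
  rewrite ler_pdivrMr//; have [xT|xT] := leP `|x| T.
    apply: le_trans (Pk x) _; have := inside x xT.
    have s0 : 0 < Num.sqrt (1 + x ^+ 2) by rewrite (lt_le_trans _ (sqrt1D_ge1 x)).
    rewrite mulrA ler_pdivlMr// mulrC => h.
    have ek : 0 <= e * (1 + k x) by rewrite mulr_ge0 ?(ltW e0)// addr_ge0.
    apply: le_trans (ler_wpM2r ek h) _.
    rewrite /B (_ : _ * _ * (1 + k x) * S x = 7 * (expR (a 0%N) * S x * (e * (1 + k x)))); last by ring.
    by rewrite ler_peMl ?mulr_ge0 ?expR_ge0 ?(ltW (S0 x)) ?(ltW e0) ?addr_ge0//; lra.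
  apply: le_trans (outside x xT) _; rewrite ler_pM2r//.
  apply: (@le_trans _ _ B); last by rewrite ler_peMr// ltW.
  by rewrite /B mulrAC ler_peMr// mulr_ge0// ltW.
have szb : (size P <= (size (poles n J)).+1)%N.
  apply: leq_trans sP _; rewrite ltnS /poles !size_cat !size_nseq; lia.
have [A A0] := poisson_quotient szb (poles_ge1 n J).
rewrite Pi cabs1 => le1.
have mG : measurable_fun setT (fun x : R => 2 * cabs P.[x%:C%C] / S x).
  apply: continuous_measurable_fun => x; apply: cvgM.
    by apply: cvgM; [exact: cvg_cst|exact: continuous_cabs_horner].
  apply: cvgV; first by rewrite gt_eqF.
  apply: continuous_prod => b {}x.
  apply: (@continuous_comp R R R (fun x => 1 + (x / b) ^+ 2) (@Num.sqrt R));
    last exact: sqrt_continuous.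
  apply: cvgD; first exact: cvg_cst.
  by apply: cvgM; apply: cvgM; (exact: cvg_id || exact: cvg_cst).
have GB (x : R) : 0 <= 2 * cabs P.[x%:C%C] / S x <= 2 * B * (1 + k x).
  apply/andP; split; first by rewrite divr_ge0 ?mulr_ge0 ?cabs_ge0 ?(ltW (S0 x)).
  by rewrite -mulrA -[leRHS]mulrA ler_pM2l.
have := le_trans le1 (integral_poisson_le A (mulr_ge0 (ler0n _ 2) (ltW B0)) mk k0 Ik mG GB).
have dp := poles_at_i n J.
have p0 : 0 < \prod_(b <- poles n J) (1 + b^-1).
  rewrite big_seq; apply: prodr_gt0 => b /(allP (poles_ge1 n J)) b1.
  by rewrite ltr_pwDl// invr_ge0 (le_trans ler01).
rewrite lee_fin ler_pdivrMr// => h; apply: le_trans h _.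
rewrite /B (_ : 5 * (2 * _) = e * (70 * expR (a 0%N))); last by ring.
by rewrite ler_wpM2l// mulr_ge0 ?(ltW e0)// mulr_ge0 ?expR_ge0.
Qed.

End Weight.
End LowerBound.

(** * Upper bound *)

Section UpperBound.
Variable R : realType.

(** [1 - P / P (i)] vanishes at [i]; dividing out the root turns [P] of degree [n] into an
    admissible approximant of degree [n - 1]. *)
Lemma factor_at_i (n : nat) (P : {poly R[i]}) : (size P <= n.+1)%N -> P.['i%C] != 0 ->
  exists2 Q : {poly R[i]}, (size Q <= n)%N &
    1 - ('X - 'i%C%:P) * Q = (P.['i%C])^-1 *: P.
Proof.
move=> sP Pi0; have : root (1 - (P.['i%C])^-1 *: P) 'i%C.
  by rewrite rootE hornerD hornerN hornerZ hornerC mulVf// subrr.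
case/factor_theorem => Q QE; exists Q; last by rewrite mulrC -QE subKr.
have [->|Q0] := eqVneq Q 0; first by rewrite size_poly0.
have : (size (Q * ('X - 'i%C%:P))%R <= n.+1)%N.
  rewrite -QE; apply: leq_trans (size_polyD _ _) _; rewrite size_poly1 size_polyN geq_max /=.
  exact: leq_trans (size_scale_leq _ _) sP.
by rewrite size_Mmonic ?monicXsubC// size_XsubC addn2.
Qed.

Lemma expR_half_le (t : R) : 0 <= t <= 1 -> expR (t / 2) <= 1 + t.
Proof.
case/andP=> t0 t1; have e0 : 0 < expR (t / 2) by exact: expR_gt0.
have h : expR (t / 2) * (1 - t / 2) <= 1.
  have := ler_wpM2l (ltW e0) (expR_ge1Dx (- (t / 2))).
  by rewrite -expRD subrr expR0.
have : 1 <= (1 + t) * (1 - t / 2) by nra.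
have : 0 < 1 - t / 2 by lra.
move: (expR _) e0 h => E e0 h d0 h1.
by rewrite -(ler_pM2r d0); exact: le_trans h h1.
Qed.

Lemma dyadic_scale (x : R) : exists i, `|x| <= 2 ^+ i.+1 /\ (i = 0%N \/ 2 ^+ i < `|x|).
Proof.
have : exists m, `|x| <= 2 ^+ m.+1.
  exists (Num.trunc `|x|); apply: (@le_trans _ _ (Num.trunc `|x|).+1%:R).
    by rewrite ltW// truncnS_gt.
  by rewrite -natrX ler_nat; apply: leq_trans (ltn_expl _ (ltnSn 1)) _; rewrite leq_exp2l.
case/ex_minnP => -[|i] xi imin; first by exists 0%N; split; [|left].
exists i.+1; split=> //; right; rewrite ltNge; apply/negP => /imin.
by rewrite ltnn.
Qed.

Section Weight.
Variable phi : R -> R.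
Hypothesis phi_ge0 : forall x : R, 0 <= x -> 0 <= phi x.
Hypothesis phi_homo : {in `[0, +oo[ &, {homo phi : x y / x <= y}}.

Let phi_le (x y : R) : 0 <= x -> x <= y -> phi x <= phi y.
Proof.
by move=> x0 xy; apply: phi_homo; rewrite ?in_itv/= ?andbT//; exact: le_trans xy.
Qed.

Let a (j : nat) : R := phi (2 ^+ j).
Let W (x : R) : R := expR (phi `|x|).
Let D n J := \sum_(j < J.+1) a j / 2 ^+ j + n%:R / 2 ^+ J.

Let a0 j : 0 <= a j. Proof. by rewrite phi_ge0// exprn_ge0. Qed.

(** Multiplying [|P| <= sqrt (B W)] by [sqrt (1 + x^2) <= sqrt (V W)] gives
    [|P| sqrt (1 + x^2) <= sqrt (B V) W], exactly the decay [wnorm_le_of_decay] asks for. *)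
Lemma upper_of_poly p (n : nat) (P : {poly R[i]}) (B V : R) : (1 <= p)%E ->
  (size P <= n.+1)%N -> 0 < cabs P.['i%C] -> 0 < B -> 0 < V ->
  (forall x : R, cabs P.[x%:C%C] ^+ 2 <= B * W x) ->
  (forall x : R, 1 + x ^+ 2 <= V * W x) ->
  exists2 Q : {poly R[i]}, (size Q <= n)%N &
    (wnorm p W (cauchy_error Q) <=
       (pi * (Num.sqrt (B * V) / cabs P.['i%C]))%:E)%E.
Proof.
move=> p1 sP Pi B0 V0 PB WV.
have Pi0 : P.['i%C] != 0 by apply: contraTneq Pi => ->; rewrite cabs0 ltxx.
have [Q sQ QE] := factor_at_i sP Pi0; exists Q => //.
have BV : 0 < Num.sqrt (B * V) by rewrite sqrtr_gt0 mulr_gt0.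
apply: wnorm_le_of_decay => //.
- by rewrite divr_gt0.
- exact: measurable_weighted_error.
move=> x; have W0 : 0 < W x by exact: expR_gt0.
have x2 : 0 < 1 + x ^+ 2 by rewrite ltr_pwDl ?sqr_ge0.
have s0 : 0 < Num.sqrt (1 + x ^+ 2) by rewrite sqrtr_gt0.
rewrite divr_ge0 ?cabs_ge0 ?(ltW W0)//=.
rewrite cauchy_errorE QE hornerZ cabsM cabsV.
set y := cabs P.[x%:C%C]; set z := cabs P.['i%C] in Pi *; set s := Num.sqrt (1 + _) in s0 *.
have key : y * (1 + x ^+ 2) <= Num.sqrt (B * V) * s * W x.
  have y0 : 0 <= y by exact: cabs_ge0.
  rewrite -(@ler_pXn2r _ 2%N)// ?nnegrE ?mulr_ge0 ?(ltW s0) ?(ltW BV) ?(ltW W0) ?(ltW x2)//.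
  rewrite !exprMn !sqr_sqrtr ?(ltW x2)// ?mulr_ge0 ?(ltW B0) ?(ltW V0)//.
  have h := ler_pM (sqr_ge0 y) (ltW x2) (PB x) (WV x).
  by have := ler_wpM2r (ltW x2) h; lra.
rewrite ler_pdivlMr// [leLHS](_ : _ = y * (1 + x ^+ 2) / (z * s * W x)); last first.
  by field; rewrite !gt_eqF.
rewrite ler_pdivrMr ?mulr_gt0//; apply: le_trans key _.
by rewrite le_eqVlt; apply/orP; left; apply/eqP; field; rewrite gt_eqF.
Qed.

End Weight.
End UpperBound.

(** * Test polynomials for normal growth *)

Section NormalGrowth.
Variable R : realType.
Variable phi : R -> R.
Hypothesis phi_ge0 : forall x : R, 0 <= x -> 0 <= phi x.
Hypothesis phi_homo : {in `[0, +oo[ &, {homo phi : x y / x <= y}}.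

Let phi_le (x y : R) : 0 <= x -> x <= y -> phi x <= phi y.
Proof.
by move=> x0 xy; apply: phi_homo; rewrite ?in_itv/= ?andbT//; exact: le_trans xy.
Qed.

Let a (j : nat) : R := phi (2 ^+ j).
Let W (x : R) : R := expR (phi `|x|).
Let D n J := \sum_(j < J.+1) a j / 2 ^+ j + n%:R / 2 ^+ J.

Let a0 j : 0 <= a j. Proof. by rewrite phi_ge0// exprn_ge0. Qed.

Lemma normal_poly (j0 : nat) :
  (forall j, (j0 <= j)%N -> a j.+1 <= 4 * a j) ->
  (forall j, (j0 <= j)%N -> a j.+1 - a j <= a j.+2 - a j.+1) ->
  exists c B C2 : R, [/\ 0 < c, 0 < B &
    forall n J, (j0 <= J)%N -> a J <= n%:R <= a J.+1 ->
    exists P : {poly R[i]}, [/\ (size P <= n.+1)%N,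
      forall x : R, cabs P.[x%:C%C] ^+ 2 <= B * W x &
      expR (c * D n J - C2) <= cabs P.['i%C]]].
Proof.
move=> a4 acv; pose al j := a (j0 + j)%N; pose be j : R := 2 ^+ (j0 + j).
have al0 j : 0 <= al j by exact: a0.
have al4 j : al j.+1 <= 4 * al j by rewrite /al addnS a4// leq_addr.
have alcv j : al j.+1 - al j <= al j.+2 - al j.+1 by rewrite /al !addnS acv// leq_addr.
have be0 j : 0 < be j by rewrite exprn_gt0.
have be1 j : 1 <= be j by rewrite exprn_ege1// ler1n.
pose C1 : R := \sum_(j < j0) a j / 2 ^+ j.
pose K : R := al 0%N / be 0%N.
(* As [n <= a_(J+1) <= 4 a_J], [D] is at most [C1] plus 5 times the shifted sum, itself at most 6
   times its peaks, of which [log |P (i)|] keeps 1/320: 5 * 6 * 320 = 60 * 160. [K] pays for the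
   discarded peak 0, and 1 for rounding the multiplicities. *)
exists (60^-1 / 160), (expR (al 0%N)), (C1 * (60^-1 / 160) + K / 320 + 1).
split; [by rewrite divr_gt0// invr_gt0|exact: expR_gt0|].
move=> n J j0J /andP[aJ aJ1]; pose m := (J - j0)%N.
have Jm : J = (j0 + m)%N by rewrite subnKC.
pose S j := peak al m j && (0 < j)%N.
(* 160 = 2 * 80: 80 from [peaks_growth], 2 because [|P|^2] is compared with [W]. *)
pose c j := Num.trunc (al j / 160).
have c_le j : (c j)%:R <= al j / 160 by rewrite truncn_le divr_ge0.
have c_ge j : al j / 160 - 1 <= (c j)%:R by rewrite lerBlDr natr1 ltW// truncnS_gt.
pose fac j : {poly R[i]} := 1 - ('i%C * ((be j)^-1)%:C%C) *: 'X.
have facE j z : (fac j).[z] = 1 - 'i%C * ((be j)^-1)%:C%C * z.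
  by rewrite /fac hornerD hornerN hornerZ hornerX hornerC.
pose P := \prod_(j < m.+1 | S j) fac j ^+ c j.
exists P.
have sumgrow i : \sum_(j < m.+1 | S j) (c j)%:R *
    (2 * (if (j <= i)%N then 2 * (i - j).+1%:R else 4 * (1 / 4) ^+ (j - i))) <= al i.
  have := peaks_growth al0 al4 alcv m i; set X := \sum_(j < m.+1 | _) _ => h.
  apply: (@le_trans _ _ (X / 80)); last by lra.
  rewrite /X mulr_suml; apply: ler_sum => j _.
  set k := (if _ then _ else _).
  have k0 : 0 <= k.
    by rewrite /k; case: ifP => _; rewrite mulr_ge0// exprn_ge0// divr_ge0.
  apply: le_trans (ler_wpM2r _ (c_le j)) _; first by rewrite mulr_ge0.
  by rewrite le_eqVlt; apply/orP; left; apply/eqP; field.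
split.
- have sfac j : (size (fac j) <= 2)%N.
    apply: leq_trans (size_polyD _ _) _; rewrite size_poly1 size_polyN geq_max /=.
    by apply: leq_trans (size_scale_leq _ _) _; rewrite size_polyX.
  have : (size P <= (\sum_(j < m.+1 | S j) c j).+1)%N.
    rewrite /P; elim/big_ind2: _ => [|s p1 t p2 h1 h2|j _]; first by rewrite size_poly1.
      apply: leq_trans (size_polyMleq _ _) _; move: h1 h2; lia.
    apply: leq_trans (size_poly_exp_leq _ _) _; rewrite ltnS.
    by rewrite -[leqRHS]mul1n leq_mul2r; apply/orP; right; rewrite -ltnS; move: (sfac j); case: size.
  (* The degree bound is the growth bound at the last index [m], where every weight is at least
     1. *)
  move/leq_trans; apply; rewrite ltnS -(ler_nat R) natr_sum.
  apply: le_trans aJ; rewrite Jm -/(al m); apply: le_trans (sumgrow m).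
  apply: ler_sum => j _; rewrite ler_peMr//.
  have jm : (j <= m)%N by rewrite -ltnS.
  rewrite jm; have : 1 <= (m - j).+1%:R :> R by rewrite ler1n.
  lra.
- move=> x; have [i [xi xi']] := dyadic_scale (x / be 0%N).
  have be0E j : be j = be 0%N * 2 ^+ j by rewrite /be addn0 exprD.
  have xn : `|x / be 0%N| = `|x| / be 0%N by rewrite normrM normfV (ger0_norm (ltW (be0 _))).
  rewrite xn in xi xi'.
  (* The index [i = 0] also covers small [x], where [phi |x|] may lie below [al 0]; the constant [B]
     absorbs this. *)
  have alx : al i <= al 0%N + phi `|x|.
    case: xi' => [->|ix]; first by rewrite lerDl phi_ge0.
    rewrite -[leLHS]add0r lerD// phi_le ?exprn_ge0//.
    by rewrite -/(be i) be0E ltW// mulrC -ltr_pdivlMr.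
  rewrite -expRD -cabsX; apply: (@le_trans _ _ (expR (al i))); last by rewrite ler_expR.
  rewrite /P horner_prod -prodrXl cabs_prod.
  apply: (@le_trans _ _ (\prod_(j < m.+1 | S j) expR ((c j)%:R *
      (2 * (if (j <= i)%N then 2 * (i - j).+1%:R else 4 * (1 / 4) ^+ (j - i)))))); last first.
    by rewrite -expR_sum ler_expR.
  apply: ler_prod => j _; rewrite cabs_ge0/= horner_exp facE -exprM mulnC exprM cabsX.
  rewrite expRM_natl; apply: lerXn2r; rewrite ?nnegrE ?cabs_ge0 ?expR_ge0//.
  rewrite cabsX -mulrA -rmorphM cabs_1Bi sqr_sqrtr ?addr_ge0 ?sqr_ge0//.
  have tle : ((be j)^-1 * x) ^+ 2 <= (2 ^+ i.+1 / 2 ^+ j) ^+ 2.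
    rewrite -(real_normK (num_real _)) lerXn2r ?nnegrE ?divr_ge0 ?exprn_ge0//.
    rewrite normrM normfV (ger0_norm (ltW (be0 _))) be0E invfM mulrAC.
    by rewrite ler_pM2r ?invr_gt0 ?exprn_gt0// mulrC.
  apply: (@le_trans _ _ (1 + (2 ^+ i.+1 / 2 ^+ j) ^+ 2)); first by rewrite lerD2l.
  case: ifPn => [ji|]; last first.
    rewrite -ltnNge => ij; apply: le_trans (expR_ge1Dx _); rewrite lerD2l.
    rewrite -(subnKC (ltnW ij)) exprD [2 ^+ i.+1]exprS; set d := (j - i)%N.
    have i0 : 0 < 2 ^+ i :> R by rewrite exprn_gt0.
    rewrite (_ : 2 * 2 ^+ i / (2 ^+ i * 2 ^+ d) = 2 / 2 ^+ d); last first.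
      by field; rewrite !gt_eqF ?exprn_gt0.
    rewrite expr_div_n -exprM mulnC exprM addKn.
    rewrite (_ : (1 / 4) ^+ d = ((2 ^+ 2) ^+ d)^-1); last by rewrite -exprVn; congr (_ ^+ _); field.
    have : 0 <= ((2 ^+ 2) ^+ d)^-1 :> R by rewrite invr_ge0 !exprn_ge0.
    by rewrite mulrA; set w := _^-1; rewrite expr2; lra.
  (* Here [1 + 4 * 4^d <= 16 * 4^d <= e^(4 (d + 1))], from [e >= 2]. *)
  have -> : 2 ^+ i.+1 = 2 * (2 ^+ j * 2 ^+ (i - j)) :> R by rewrite -exprD subnKC// exprS.
  set d := (i - j)%N.
  have j00 : 0 < 2 ^+ j :> R by rewrite exprn_gt0.
  rewrite (_ : 2 * (2 ^+ j * 2 ^+ d) / 2 ^+ j = 2 * 2 ^+ d); last by field; rewrite gt_eqF.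
  rewrite exprMn -exprM mulnC exprM.
  rewrite (_ : 2 * (2 * d.+1%:R) = d.+1%:R * 4); last by ring.
  rewrite expRM_natl; have e16 : 16 <= expR 4 :> R.
    have -> : expR 4 = expR 1 ^+ 4 :> R by rewrite -expRM_natl mulr1.
    have e2 := expR1_ge2 R.
    apply: (@le_trans _ _ (2 ^+ 4)); first by rewrite !exprS expr0; lra.
    by apply: lerXn2r; rewrite ?nnegrE; lra.
  have w1 : 1 <= (2 ^+ 2) ^+ d :> R by rewrite exprn_ege1// exprn_ege1// ler1n.
  have le16 : (2 ^+ 2) ^+ d <= expR 4 ^+ d :> R.
    apply: lerXn2r; rewrite ?nnegrE ?exprn_ge0 ?expR_ge0//.
    by apply: le_trans e16; rewrite expr2; lra.
  rewrite [expR 4 ^+ d.+1]exprS; apply: (@le_trans _ _ (16 * (2 ^+ 2) ^+ d)).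
    by move: w1; move: ((2 ^+ 2) ^+ d) => w w1; rewrite expr2; lra.
  by apply: ler_pM => //; rewrite exprn_ge0// exprn_ge0.
- have -> : cabs P.['i%C] = \prod_(j < m.+1 | S j) (1 + (be j)^-1) ^+ c j.
    rewrite /P horner_prod cabs_prod; apply: eq_bigr => j _.
    rewrite horner_exp cabsX facE; congr (_ ^+ _).
    rewrite mulrAC -expr2 sqr_i mulN1r opprK -[1](rmorph1 (real_complex R)) -rmorphD cabs_real.
    by rewrite ger0_norm// addr_ge0// invr_ge0 ltW.
  apply: (@le_trans _ _ (\prod_(j < m.+1 | S j) expR ((c j)%:R * ((be j)^-1 / 2)))); last first.
    apply: ler_prod => j _; rewrite expR_ge0/= expRM_natl.
    apply: lerXn2r; rewrite ?nnegrE ?expR_ge0 ?addr_ge0 ?invr_ge0 ?(ltW (be0 _))//.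
    by apply: expR_half_le; rewrite invr_ge0 (ltW (be0 _))/= invf_le1.
  rewrite -expR_sum ler_expR.
  have be0E j : be j = be 0%N * 2 ^+ j by rewrite /be addn0 exprD.
  pose b j : R := al j / be j; have b0 j : 0 <= b j by rewrite divr_ge0// ltW.
  have mass : \sum_(j < m.+1) b j <= 6 * \sum_(j < m.+1 | peak al m j) b j.
    have h := peaks_mass m al0; have i0 : 0 <= (be 0%N)^-1 by rewrite invr_ge0 ltW.
    have := ler_wpM2r i0 h; rewrite -mulrA !mulr_suml.
    by under [X in X <= _ -> _]eq_bigr do rewrite -mulrA -invfM [_ * be 0%N]mulrC -be0E;
       under [X in _ <= _ * X -> _]eq_bigr do rewrite -mulrA -invfM [_ * be 0%N]mulrC -be0E.
  have split0 : \sum_(j < m.+1 | peak al m j) b j <= K + \sum_(j < m.+1 | S j) b j.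
    rewrite (bigID (fun j : 'I_m.+1 => (0 < j)%N))/= addrC lerD2r.
    rewrite big_mkcond big_ord_recl/= big1 ?addr0; last by move=> j _; rewrite andbF.
    by rewrite andbT; case: ifP => // _; exact: b0.
  have geo : \sum_(j < m.+1 | S j) (be j)^-1 <= 2.
    apply: (@le_trans _ _ (\sum_(j < m.+1) 2^-1 ^+ j)).
      rewrite big_mkcond/=; apply: ler_sum => j _; case: ifP => _; last by rewrite exprn_ge0.
      rewrite exprVn be0E lef_pV2 ?posrE ?mulr_gt0 ?exprn_gt0//.
      by rewrite ler_peMl ?exprn_ge0.
    by apply: sum_geo_le; [apply/andP; split|]; lra.
  have low : (\sum_(j < m.+1 | S j) b j) / 320 - (\sum_(j < m.+1 | S j) (be j)^-1) / 2
      <= \sum_(j < m.+1 | S j) (c j)%:R * ((be j)^-1 / 2).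
    rewrite !mulr_suml -sumrB; apply: ler_sum => j _.
    have i0 : 0 <= (be j)^-1 / 2 by rewrite divr_ge0 ?invr_ge0 ?(ltW (be0 _)).
    by have := ler_wpM2r i0 (c_ge j); rewrite /b; lra.
  have DE : D n J = C1 + \sum_(j < m.+1) b j + n%:R / 2 ^+ J.
    rewrite /D Jm -addnS big_split_ord/=; congr (_ + _ + _).
  have nJ : n%:R / 2 ^+ J <= 4 * \sum_(j < m.+1) b j.
    apply: (@le_trans _ _ (4 * b m)).
      rewrite mulrA /b /be -Jm ler_pM2r ?invr_gt0 ?exprn_gt0//.
      by apply: le_trans aJ1 _; rewrite Jm -addnS; exact: al4.
    rewrite ler_pM2l// big_ord_recr/= lerDr; exact: sumr_ge0.
  rewrite DE; lra.
Qed.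

End NormalGrowth.

(** * Test polynomials for rapid growth *)

Section RapidGrowth.
Variable R : realType.
Variable phi : R -> R.
Hypothesis phi_ge0 : forall x : R, 0 <= x -> 0 <= phi x.
Hypothesis phi_homo : {in `[0, +oo[ &, {homo phi : x y / x <= y}}.

Let phi_le (x y : R) : 0 <= x -> x <= y -> phi x <= phi y.
Proof.
by move=> x0 xy; apply: phi_homo; rewrite ?in_itv/= ?andbT//; exact: le_trans xy.
Qed.

Let a (j : nat) : R := phi (2 ^+ j).
Let W (x : R) : R := expR (phi `|x|).
Let D n J := \sum_(j < J.+1) a j / 2 ^+ j + n%:R / 2 ^+ J.

Let a0 j : 0 <= a j. Proof. by rewrite phi_ge0// exprn_ge0. Qed.

Lemma rapid_poly (eps A : R) : 0 < eps -> 0 < A ->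
  {in `[A, +oo[ &, {homo (fun x => phi x / x `^ (1 + eps)) : x y / x <= y}} ->
  exists c B C2 : R, exists j0 : nat, [/\ 0 < c, 0 < B &
    forall n J, (j0 <= J)%N -> a J <= n%:R <= a J.+1 ->
    exists P : {poly R[i]}, [/\ (size P <= n.+1)%N,
      forall x : R, cabs P.[x%:C%C] ^+ 2 <= B * W x &
      expR (c * D n J - C2) <= cabs P.['i%C]]].
Proof.
move=> eps0 A0 mono.
have [j0 Aj0] : exists j0, A <= 2 ^+ j0.
  exists (Num.trunc A).+1; apply: (@le_trans _ _ (Num.trunc A).+1%:R).
    by rewrite ltW// truncnS_gt.
  by rewrite -natrX ler_nat ltnW// ltn_expl.
have grow (x y : R) : A <= x -> x <= y -> phi x * (y / x) `^ (1 + eps) <= phi y.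
  move=> Ax xy; have x0 : 0 < x by exact: lt_le_trans Ax.
  have y0 : 0 < y by exact: lt_le_trans xy.
  have := mono x y; rewrite !in_itv/= !andbT Ax (le_trans Ax xy) => /(_ isT isT xy).
  rewrite ler_pdivlMr ?powR_gt0// => h; apply: le_trans h.
  rewrite -mulrA ler_wpM2l ?phi_ge0 ?(ltW x0)// powRM ?invr_ge0 ?(ltW x0) ?(ltW y0)//.
  by rewrite mulrC -powR_inv1 ?(ltW x0)// -powRrM mulN1r powRN.
(* From [j0] on, [a_j / 2^j] grows at least by the factor [q] at each step, so its partial sums are
   controlled by the last term; [K] is the sum of the geometric series of ratio [1 / q]. *)
pose q : R := 2 `^ eps; have q1 : 1 < q.
  by rewrite /q /powR pnatr_eq0/= expR_gt1 mulr_gt0// ln_gt0// ltr1n.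
have q0 : 0 < q by exact: lt_trans q1.
pose b j : R := a j / 2 ^+ j; have b0 j : 0 <= b j by rewrite divr_ge0 ?exprn_ge0.
have bstep j : (j0 <= j)%N -> b j <= q^-1 * b j.+1.
  move=> jj; have p0 : 0 < 2 ^+ j :> R by rewrite exprn_gt0.
  have Aj : A <= 2 ^+ j by apply: le_trans Aj0 _; rewrite ler_weXn2l// ler1n.
  have := grow (2 ^+ j) (2 ^+ j.+1) Aj; rewrite ler_weXn2l ?ler1n// => /(_ isT).
  rewrite [2 ^+ j.+1 / _](_ : _ = 2); last by rewrite exprS mulfK ?gt_eqF.
  rewrite powRD ?pnatr_eq0 ?implybT// powRr1// -/q -/(a j) -/(a j.+1) => h.
  rewrite /b mulrCA ler_pdivrMr// exprS invfM.
  rewrite (_ : _ * _ = a j.+1 / (2 * q)); last by field; rewrite !gt_eqF.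
  by rewrite ler_pdivlMr ?mulr_gt0.
pose K := (1 - q^-1)^-1.
have qV : q^-1 < 1 by rewrite invf_lt1.
have qV0 : 0 < q^-1 by rewrite invr_gt0.
have K0 : 0 < K by rewrite invr_gt0 subr_gt0.
have KE : K = K * q^-1 + 1.
  have : K * (1 - q^-1) = 1 by rewrite mulVf// gt_eqF// subr_gt0.
  lra.
pose C1 := \sum_(j < j0.+1) b j; have C10 : 0 <= C1 by exact: sumr_ge0.
have sumb d : \sum_(j < (j0 + d).+1) b j <= C1 + K * b (j0 + d)%N.
  elim: d => [|d ih]; first by rewrite addn0 lerDl mulr_ge0// ltW.
  rewrite addnS big_ord_recr/= KE.
  have := ler_wpM2l (ltW K0) (bstep _ (leq_addr d j0)); lra.
(* 24 = 12 * 2, from [l] about [n / 12] and the scale [2 * 2^J]. The 2 added to [C1] covers the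
   rounding of [l] and the factor 1/2 of [chebyshev_at_i]. *)
exists (24 * (K + 1))^-1, 1, (C1 + 2), j0; split=> //.
  by rewrite invr_gt0 mulr_gt0// addr_gt0.
move=> n J j0J /andP[aJ aJ1].
have J0 : 0 < 2 ^+ J :> R by rewrite exprn_gt0.
have nJ0 : 0 <= n%:R / 2 ^+ J :> R by rewrite divr_ge0 ?exprn_ge0.
have Dle : D n J <= C1 + (K + 1) * (n%:R / 2 ^+ J).
  have := sumb (J - j0)%N; rewrite subnKC// => h.
  have bJ : b J <= n%:R / 2 ^+ J by rewrite ler_pM2r ?invr_gt0.
  by have := ler_wpM2l (ltW K0) bJ; rewrite /D; move: h; rewrite /b; lra.
(* With [u = |x| / t > 1], [|P|^2 <= (3 u)^(4 l) <= e^(12 l u) <= e^(n u)]. As [n <= phi t], rapid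
   growth gives [n u <= phi t * u^(1 + eps) <= phi |x|]. *)
pose l := (n %/ 12)%N; pose t : R := 2 ^+ J.+1.
have t0 : 0 < t by rewrite exprn_gt0.
have t1 : 1 <= t by rewrite exprn_ege1// ler1n.
pose P := chebyshev R[i] l.*2 \Po ((t^-1)%:C%C *: 'X).
have l12 : 12 * l%:R <= n%:R :> R.
  by rewrite -natrM ler_nat /l mulnC leq_trunc_div.
have l12' : n%:R <= 12 * (l%:R + 1) :> R.
  by rewrite natr1 -natrM ler_nat mulnC ltnW// ltn_ceil.
exists P; split.
- apply: leq_trans (size_comp_poly_leq _ _) _; rewrite ltnS.
  have s1 : (size ((t^-1)%:C%C *: 'X : {poly R[i]}) <= 2)%N.
    by apply: leq_trans (size_scale_leq _ _) _; rewrite size_polyX.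
  have s2 := size_chebyshev R[i] l.*2.
  have l2n : (l.*2 <= n)%N.
    by apply: leq_trans (leq_trunc_div n 12); rewrite -muln2 leq_mul2l orbT.
  apply: leq_trans l2n; rewrite -[leqRHS]muln1.
  by apply: leq_mul; rewrite -subn1 leq_subLR add1n.
- move=> x; rewrite mul1r horner_comp hornerZ hornerX -rmorphM/=.
  have xE : `|t^-1 * x| = `|x| / t by rewrite normrM mulrC normfV (ger0_norm (ltW t0)).
  have [x1|x1] := leP `|t^-1 * x| 1.
    have h := chebyshev_le1 l.*2 x1; apply: (@le_trans _ _ 1).
      by rewrite expr_le1 ?cabs_ge0.
    by rewrite -[leLHS]expR0 ler_expR phi_ge0.
  have h := chebyshev_growth l.*2 (ltW x1).
  have u0 := normr_ge0 (t^-1 * x).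
  apply: (@le_trans _ _ ((3 * `|t^-1 * x|) ^+ (4 * l))).
    have -> : (4 * l = l.*2 * 2)%N by rewrite -muln2 -mulnA mulnC.
    by rewrite exprM; apply: lerXn2r; rewrite ?nnegrE ?cabs_ge0 ?exprn_ge0 ?mulr_ge0.
  apply: (@le_trans _ _ (expR (3 * `|t^-1 * x|) ^+ (4 * l))).
    apply: lerXn2r; rewrite ?nnegrE ?expR_ge0 ?mulr_ge0//.
    by have := expR_ge1Dx (3 * `|t^-1 * x|); lra.
  rewrite -expRM_natl ler_expR; apply: (@le_trans _ _ (n%:R * `|t^-1 * x|)).
    by rewrite natrM; have := ler_wpM2r u0 l12; lra.
  have tx : t <= `|x| by move: x1; rewrite xE ltr_pdivlMr// mul1r => /ltW.
  have At : A <= t by apply: le_trans Aj0 _; rewrite ler_weXn2l ?ler1n// leqW.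
  apply: le_trans (grow t `|x| At tx); rewrite -xE; apply: ler_pM => //.
  rewrite -[leLHS]powRr1//; apply: ler_powR; first exact: ltW.
  by rewrite lerDl ltW.
- rewrite horner_comp hornerZ hornerX [_ * 'i%C]mulrC.
  have y0 : 0 <= t^-1 by rewrite invr_ge0 ltW.
  have y1 : t^-1 <= 1 by rewrite invf_le1.
  apply: le_trans (chebyshev_at_i l y0).
  have tE : t^-1 = (2 ^+ J)^-1 / 2 by rewrite /t exprS invfM mulrC.
  apply: (@le_trans _ _ (expR (l%:R * t^-1 - 1))).
    rewrite ler_expR lerBlDr.
    have c0 : 0 < 24 * (K + 1) by rewrite mulr_gt0// addr_gt0.
    have c1 : (24 * (K + 1))^-1 * D n J <= C1 + n%:R / 2 ^+ J / 24.
      rewrite mulrC ler_pdivrMr//; apply: le_trans Dle _.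
      have : 0 <= C1 * K by rewrite mulr_ge0// ltW.
      by move: C10 nJ0; move: (n%:R / 2 ^+ J) => w; lra.
    have := ler_wpM2r y0 l12'.
    have -> : n%:R / t = n%:R / 2 ^+ J / 2 by rewrite tE mulrA.
    by move: c1 y1; move: (n%:R / 2 ^+ J) (_ * D n J) => w v; lra.
  have h : expR (l%:R * t^-1) <= (1 + t^-1) ^+ l.*2.
    have := expR_half_le (t := t^-1); rewrite y0 y1 => /(_ isT) e1.
    have -> : l%:R * t^-1 = (l.*2)%:R * (t^-1 / 2) by rewrite -muln2 natrM; field; rewrite gt_eqF.
    by rewrite expRM_natl; apply: lerXn2r; rewrite ?nnegrE ?expR_ge0 ?addr_ge0.
  rewrite expRD expRN; apply: ler_pM; rewrite ?expR_ge0 ?invr_ge0 ?expR_ge0//.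
  by rewrite lef_pV2 ?posrE ?expR_gt0// expR1_ge2.
Qed.

End RapidGrowth.

(** * Reduction of the growth hypotheses to dyadic estimates *)

Section Assembly.
Variables (R : realType) (phi : R -> R).
Hypothesis phi_ge0 : forall x : R, 0 <= x -> 0 <= phi x.
Hypothesis phi_homo : {in `[0, +oo[ &, {homo phi : x y / x <= y}}.

Let a (j : nat) : R := phi (2 ^+ j).
Let D n J := \sum_(j < J.+1) a j / 2 ^+ j + n%:R / 2 ^+ J.

Lemma regular_poly : regularly_growing phi ->
  exists c B C2 : R, exists j0 : nat, [/\ 0 < c, 0 < B &
    forall n J, (j0 <= J)%N -> a J <= n%:R <= a J.+1 ->
    exists P : {poly R[i]}, [/\ (size P <= n.+1)%N,
      forall x : R, cabs P.[x%:C%C] ^+ 2 <= B * expR (phi `|x|) &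
      expR (c * D n J - C2) <= cabs P.['i%C]]].
Proof.
case=> [[_ [A [A0 [mono conv]]]]|[_ [eps [A [eps0 [A0 mono]]]]]]; last first.
  exact: (rapid_poly phi_ge0 eps0 A0 mono).
have [j0 Aj0] : exists j0, A <= 2 ^+ j0.
  exists (Num.trunc A).+1; apply: (@le_trans _ _ (Num.trunc A).+1%:R).
    by rewrite ltW// truncnS_gt.
  by rewrite -natrX ler_nat ltnW// ltn_expl.
have Aj j : (j0 <= j)%N -> A <= 2 ^+ j.
  by move=> jj; apply: le_trans Aj0 _; rewrite ler_weXn2l// ler1n.
have p0 j : 0 < 2 ^+ j :> R by rewrite exprn_gt0.
have a4 j : (j0 <= j)%N -> a j.+1 <= 4 * a j.
  move=> jj; have := mono (2 ^+ j.+1) (2 ^+ j).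
  rewrite !in_itv/= !andbT !Aj ?(leqW jj)// => /(_ isT isT).
  rewrite ler_weXn2l ?ler1n// => /(_ isT); rewrite ler_pdivrMr ?exprn_gt0//.
  move/le_trans; apply; rewrite [2 ^+ j.+1]exprS le_eqVlt; apply/orP; left; apply/eqP.
  by rewrite -/(a j); field; rewrite gt_eqF.
(* Convexity in [log x] at a midpoint: [2^(j+1)] is the geometric mean of [2^j] and [2^(j+2)]. *)
have acv j : (j0 <= j)%N -> a j.+1 - a j <= a j.+2 - a j.+1.
  move=> jj; have lnA k : (j0 <= k)%N -> ln A <= ln (2 ^+ k).
    by move=> jk; rewrite ler_ln ?posrE// Aj.
  have half01 : (0 <= 2^-1 :> R) && (2^-1 <= 1 :> R) by apply/andP; split; lra.
  have := conv (ln (2 ^+ j)) (ln (2 ^+ j.+2)) 2^-1 (lnA _ jj) (lnA _ (leqW (leqW jj))) half01.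
  have -> : 2^-1 * ln (2 ^+ j) + (1 - 2^-1) * ln (2 ^+ j.+2) = ln (2 ^+ j.+1) :> R.
    have L k : ln (2 ^+ k.+1) = ln (2 ^+ k) + ln 2 :> R by rewrite exprSr lnM ?posrE.
    by rewrite !L; lra.
  rewrite !lnK ?posrE// -/(a j) -/(a j.+1) -/(a j.+2); lra.
have [c [B [C2 [c0 B0 H]]]] := normal_poly phi_ge0 phi_homo a4 acv.
by exists c, B, C2, j0.
Qed.

Lemma weight_dominates_sqr :
  (fun t => t ^+ 2 / expR (phi `|t|)) @ +oo --> (0 : R) ->
  exists2 V : R, 0 < V & forall x : R, 1 + x ^+ 2 <= V * expR (phi `|x|).
Proof.
move=> lim; have [M [_ HM]] := @cvgr_lt R R _ _ _ 0 lim 1 ltr01.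
exists (2 + M ^+ 2) => [|x]; first by rewrite ltr_pwDl ?sqr_ge0.
have W1 : 1 <= expR (phi `|x|) by rewrite -[leLHS]expR0 ler_expR phi_ge0.
have M0 := sqr_ge0 M.
have [Mx|xM] := ltP M `|x|.
  have := HM `|x| Mx; rewrite normr_id ltr_pdivrMr ?expR_gt0// mul1r real_normK ?num_real//.
  move: (expR _) W1 => w w1 xw; have : 0 <= M ^+ 2 * w by rewrite mulr_ge0// (le_trans ler01).
  lra.
have x2 : x ^+ 2 <= M ^+ 2.
  by rewrite -(real_normK (num_real x)) lerXn2r ?nnegrE// (le_trans (normr_ge0 x)).
apply: (@le_trans _ _ (2 + M ^+ 2)); first by lra.
by rewrite ler_peMr// addr_ge0.
Qed.

(** A bound [y] on all [a_j] would bound the divergent dyadic sum by [2 y]. Unboundedness ensures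
    that every large [n] is bracketed by consecutive [a_J], [a_(J+1)]. *)
Lemma dyadic_unbounded :
  (\int[@lebesgue_measure R]_(t in `[0%R, +oo[%classic) (phi t / (1 + t ^+ 2))%:E = +oo)%E ->
  forall y : R, exists j, y < a j.
Proof.
move=> Ioo y; have [//|nex] := pselect (exists j, y < a j); exfalso.
have le j : a j <= y by rewrite leNgt; apply/negP => lt; apply: nex; exists j.
have y0 : 0 <= y by apply: le_trans (le 0%N); rewrite phi_ge0// exprn_ge0.
have [J0 /(_ J0 (leqnn _))] := dyadic_sum_diverges phi_ge0 phi_homo Ioo (2 * y + 1).
apply/negP; rewrite -ltNge; apply: (@le_lt_trans _ _ (y * 2)); last by lra.
apply: (@le_trans _ _ (y * \sum_(j < J0.+1) 2^-1 ^+ j)).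
  by rewrite mulr_sumr; apply: ler_sum => j _; rewrite exprVn;
    apply: ler_wpM2r; [rewrite invr_ge0 exprn_ge0|exact: le].
by rewrite ler_wpM2l//; apply: sum_geo_le; [apply/andP; split|]; lra.
Qed.

End Assembly.

Theorem theorem1 (R : realType) (phi : R -> R) (p : \bar R) :
  {within `[0, +oo[, continuous phi} ->
  (forall x, 0 <= x -> 0 < phi x) ->
  {in `[0, +oo[ &, {homo phi : x y / x < y}} ->
  (forall k : nat,
     (fun t => t ^+ k / expR (phi `|t|)) @ +oo --> (0 : R) /\
     (fun t => t ^+ k / expR (phi `|t|)) @ -oo --> (0 : R)) ->
  regularly_growing phi ->
  (1 <= p)%E ->
  exists c C : R, 0 < c /\ c <= C /\
    exists N : nat, forall n : nat, (N <= n)%N ->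
      exists e : R,
        E_n n p (fun x => expR (phi `|x|)) = e%:E /\ 0 < e /\
        - C * Iphi phi n <= ln e /\ ln e <= - c * Iphi phi n.
Proof.
move=> _ phi_gt0 phi_incr lim reg p1.
have phi_ge0 (x : R) : 0 <= x -> 0 <= phi x by move=> /phi_gt0/ltW.
have phi_homo : {in `[0, +oo[ &, {homo phi : x y / x <= y}}.
  move=> x y xi yi; rewrite le_eqVlt => /predU1P[->//|xy].
  exact: ltW (phi_incr _ _ xi yi xy).
have Ioo : (\int[@lebesgue_measure R]_(t in `[0%R, +oo[%classic)
    (phi t / (1 + t ^+ 2))%:E = +oo)%E.
  by case: reg => [[[_ [_ [I _]]] _]|[[_ [_ [I _]]] _]].
pose a j := phi (2 ^+ j).
pose D n J := \sum_(j < J.+1) a j / 2 ^+ j + n%:R / 2 ^+ J.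
have a_ge0 j : 0 <= a j by rewrite phi_ge0// exprn_ge0.
have a0 : 0 < a 0%N by exact: phi_gt0.
have a_le i j : (i <= j)%N -> a i <= a j.
  move=> ij; apply: phi_homo; rewrite ?in_itv/= ?andbT ?exprn_ge0//.
  by rewrite ler_weXn2l// ler1n.
have [c [B [C2 [j0 [c0 B0 polys]]]]] := regular_poly phi_ge0 phi_homo reg.
have [V V0 WV] := weight_dominates_sqr phi_ge0 (lim 2%N).1.
pose s := pi * Num.sqrt (B * V).
have s0 : 0 < s by rewrite mulr_gt0 ?pi_gt0// sqrtr_gt0 mulr_gt0.
pose C5 := ln s + C2.
(* [C5] collects the additive losses of the upper bound; from [J0] on, half of [c D] absorbs them,
   and the other half is the final [c / 2]. *)
have [J0 divJ0] := dyadic_sum_diverges phi_ge0 phi_homo Ioo (2 * C5 / c).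
pose Jm := maxn j0 J0.
have K0 : 0 < 2 * (74 + a 0%N) / a 0%N by rewrite divr_gt0// mulr_gt0// addr_gt0.
(* 66 turns [33 D] into a multiple of the integral [I], since [D <= 2 I]. The middle term absorbs
   [74 + a 0] through [I >= a 0 / 2], with 74 = 70 + 4 and [70 < e^70]. The last term secures
   [c / 2 <= C]. *)
exists (c / 2), (66 + 2 * (74 + a 0%N) / a 0%N + c / 2).
split; first by rewrite divr_gt0.
split; first by lra.
exists (Num.trunc (a Jm)).+1 => n Nn.
have aJm : a Jm < n%:R by apply: lt_le_trans (truncnS_gt _) _; rewrite ler_nat.
(* [J + 1] is the least index [m] with [n <= a m]; [a Jm < n] forces it beyond [Jm]. *)
have [J JmJ bracket] : exists2 J, (Jm <= J)%N & a J <= n%:R <= a J.+1.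
  have : exists m, n%:R <= a m.
    by have [j nj] := dyadic_unbounded phi_ge0 phi_homo Ioo n%:R; exists j; exact: ltW.
  case/ex_minnP => m nm mmin.
  have : (Jm < m)%N.
    by rewrite ltnNge; apply/negP => /a_le am; have := le_lt_trans (le_trans nm am) aJm; rewrite ltxx.
  case: m nm mmin => // J nJ mmin JJ; exists J => //; rewrite nJ andbT leNgt.
  by apply/negP => /ltW/mmin; rewrite ltnn.
have [I1 I2] := Iphi_dyadic phi_ge0 phi_homo bracket.
rewrite -/(D n J) in I1 I2; set I := Iphi phi n in I1 I2 *.
have nJ0 : 0 <= n%:R / 2 ^+ J :> R by rewrite divr_ge0 ?exprn_ge0.
have Da0 : a 0%N <= D n J.
  rewrite /D big_ord_recl/= expr0 divr1 -addrA lerDl addr_ge0// sumr_ge0// => j _.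
  by rewrite divr_ge0 ?exprn_ge0.
have DC5 : C5 <= c / 2 * D n J.
  have := divJ0 J (leq_trans (leq_maxr _ _) JmJ); rewrite -/a => h.
  have : 2 * C5 / c <= D n J by rewrite /D; lra.
  by rewrite ler_pdivrMr//; lra.
pose C := 66 + 2 * (74 + a 0%N) / a 0%N + c / 2.
have CI : 74 + a 0%N + 33 * D n J <= C * I.
  have Ia : a 0%N / 2 <= I by lra.
  have h1 : 74 + a 0%N <= 2 * (74 + a 0%N) / a 0%N * I.
    apply: le_trans (ler_wpM2l (ltW K0) Ia).
    by rewrite le_eqVlt; apply/orP; left; apply/eqP; field; rewrite gt_eqF.
  have h2 : 0 <= c / 2 * I by rewrite mulr_ge0 ?divr_ge0 ?(ltW c0)//; lra.
  by rewrite /C; lra.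
set W := fun x : R => expR (phi `|x|).
have [P [sP PB Pi]] := polys n J (leq_trans (leq_maxl _ _) JmJ) bracket.
have Pi0 : 0 < cabs P.['i%C] by apply: lt_le_trans Pi; exact: expR_gt0.
have [Q sQ wQ] := upper_of_poly phi_homo p1 sP Pi0 B0 V0 PB WV.
have up : (E_n n p W <= (expR (- (c / 2) * I))%:E)%E.
  apply: (@le_trans _ _ (wnorm p W (cauchy_error Q))).
    by apply: ereal_inf_lbound; exists Q.
  apply: le_trans wQ _; rewrite lee_fin mulrA -/s ler_pdivrMr//.
  apply: (@le_trans _ _ (expR (- (c / 2) * I) * expR (c * D n J - C2))); last first.
    by rewrite ler_wpM2l ?expR_ge0.
  rewrite -expRD -[leLHS]lnK ?posrE// ler_expR.
  have cI : c / 2 * I <= c / 2 * D n J by rewrite ler_wpM2l// divr_ge0// ltW.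
  by move: DC5; rewrite /C5; lra.
have lo : ((expR (- C * I))%:E <= E_n n p W)%E.
  apply: le_ereal_inf_tmp => _ [Q' /= sQ' <-]; rewrite leNgt; apply/negP => /ltW lt.
  have := lower_bound phi_ge0 phi_homo p1 (expR_gt0 _) bracket sQ' lt.
  apply/negP; rewrite -ltNge.
  have h70 : 70 < expR 70 :> R by apply: lt_le_trans (expR_ge1Dx 70); lra.
  apply: (@lt_le_trans _ _ (expR (- C * I) * (expR 70 * expR (a 0%N)) * expR (4 + 33 * D n J))).
    by rewrite ltr_pM2r ?expR_gt0// ltr_pM2l ?expR_gt0// ltr_pM2r ?expR_gt0.
  rewrite -!expRD -[leRHS]expR0 ler_expR; lra.
have Efin : E_n n p W \is a fin_num.
  by rewrite fin_numE -ltNye -ltey (lt_le_trans _ lo) ?ltNyr// (le_lt_trans up) ?ltry.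
move: up lo; rewrite -(fineK Efin) !lee_fin => up lo.
have e0 : 0 < fine (E_n n p W) by apply: lt_le_trans lo; exact: expR_gt0.
exists (fine (E_n n p W)); split=> //; split=> //; split.
  by rewrite -[leLHS]expRK ler_ln ?posrE ?expR_gt0.
by rewrite -[leRHS]expRK ler_ln ?posrE ?expR_gt0.
Qed.
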